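(* Every connected edge-weighted graph $G=(V,E,w)$ on at least $2$ vertices with doubling dimension $d$, and with minimum pairwise distance $1$, admits a $\gamma$-hierarchy of strong $(\alpha,\tau)$-sparse partitions for some $\alpha=O(d)$, $\tau=\tilde O(d)$ and $\gamma=\tilde O(d^3)$ (with universal constants).
   Context: Graphs are finite and undirected with positive edge weights; $d_G$ is the shortest-path distance, $B_G(v,r)=\{u: d_G(u,v)\le r\}$, and $G[C]$ is the subgraph induced by $C\subseteq V$. It is assumed (by scaling) that the minimum distance between distinct vertices of $G$ is $1$. A strong $\Delta$-diameter $(\alpha,\tau)$-sparse partition of $G$ is a partition $\mathcal C$ of $V$ such that: (1) for every $C\in\mathcal C$ the induced graph $G[C]$ has diameter at most $\Delta$ (distances measured in $G[C]$); (2) for every $v\in V$, the ball $B_G(v,\Delta/\alpha)$ intersects at most $\tau$ clusters of $\mathcal C$. A $\gamma$-hierarchy of strong $(\alpha,\tau)$-sparse partitions consists of partitions $\{\{v\}:v\in V\}=\mathcal C_0,\mathcal C_1,\dots,\mathcal C_k=\{V\}$ of $V$ such that: (1) $\mathcal C_i$ is a strong $\gamma^i$-diameter $(\alpha,\tau)$-sparse partition for every $i$; (2) $\mathcal C_{i+1}$ coarsens $\mathcal C_i$, i.e. each $U\in\mathcal C_i$ is contained in some $U'\in\mathcal C_{i+1}$. A metric space has doubling constant $\lambda$ if for every point $x$ and $r>0$ the closed ball $B(x,2r)$ can be covered by $\lambda$ balls of radius $r$; its doubling dimension is $\log_2\lambda$ (with $\lambda$ the least such constant). The doubling dimension of a weighted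 graph is that of its shortest-path metric. $\tilde O(d^k)$ hides polylogarithmic factors in $d$: it denotes a bound $Kd^k(1+\log d)^K$ with $K$ a universal constant. *)

(* Defs.v *)
From mathcomp Require Import all_boot all_order all_algebra.
From mathcomp Require Import all_classical all_reals all_analysis.

Set Implicit Arguments.
Unset Strict Implicit.
Unset Printing Implicit Defensive.

Import Order.TTheory GRing.Theory Num.Theory.

Local Open Scope ring_scope.

(* The value of wt on non-adjacent pairs is irrelevant. *)
Record wgraph (R : realType) (V : finType) := WGraph {
  adj : rel V;
  wt : V -> V -> R;
  adj_sym : symmetric adj;
  adj_irr : irreflexive adj;
  wt_sym : forall x y, adj x y -> wt x y = wt y x;
  wt_gt0 : forall x y, adj x y -> 0 < wt x y }.

Section Distance.
Variables (R : realType) (V : finType) (G : wgraph R V).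

Definition wconnected : Prop := forall x y : V, connect (adj G) x y.

(* p lists the vertices of the walk after its origin x, as in path. *)
Fixpoint walk_weight (x : V) (p : seq V) : R :=
  if p is y :: p' then wt G x y + walk_weight y p' else 0.

(* Distances are extended reals: vertices that no walk joins are at distance
   ereal_inf set0 = +oo, so a disconnected graph has infinite diameter. *)
Definition gdist (x y : V) : \bar R :=
  ereal_inf [set (walk_weight x p)%:E |
             p in [set p | path (adj G) x p /\ last x p = y]]%classic.

Definition gball (v : V) (r : R) : {set V} :=
  [set u | (gdist u v <= r%:E)%E]%SET.

Definition gdiam : \bar R :=
  ereal_sup [set gdist xy.1 xy.2 | xy in [set: V * V]]%classic.

Definition min_dist_one : Prop :=
  (forall x y : V, x != y -> (1%:E <= gdist x y)%E) /\
  (exists x y : V, x != y /\ gdist x y = 1%:E).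

Definition has_doubling_constant (l : nat) : Prop :=
  forall (x : V) (r : R), 0 < r ->
  exists S : {set V}, (#|S| <= l)%N /\
    gball x (2 * r) \subset (\bigcup_(s in S) gball s r)%SET.

Lemma gdist_refl_le0 (x : V) : (gdist x x <= 0%:E)%E.
Proof. by apply: ereal_inf_lbound; exists [::]. Qed.

Lemma ex_doubling_constant : exists l, `[< has_doubling_constant l >].
Proof.
exists #|V|; apply/asboolP => x r r0; exists [set: V]%SET; split.
  by rewrite cardsT.
apply/fintype.subsetP => y _; apply/finset.bigcupP; exists y; first by rewrite inE.
by rewrite inE (le_trans (gdist_refl_le0 y))// lee_fin ltW.
Qed.

Definition doubling_constant : nat := ex_minn ex_doubling_constant.

Definition doubling_dim : R := ln doubling_constant%:R / ln 2.

End Distance.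

Section Induced.
Variables (R : realType) (V : finType) (G : wgraph R V) (C : {set V}).

Let T := {x : V | x \in C}.
Let iadj : rel T := fun x y => adj G (val x) (val y).
Let iwt (x y : T) : R := wt G (val x) (val y).

Fact iadj_sym : symmetric iadj.
Proof. by move=> x y; apply: adj_sym. Qed.

Fact iadj_irr : irreflexive iadj.
Proof. by move=> x; apply: adj_irr. Qed.

Fact iwt_sym x y : iadj x y -> iwt x y = iwt y x.
Proof. exact: wt_sym. Qed.

Fact iwt_gt0 x y : iadj x y -> 0 < iwt x y.
Proof. exact: wt_gt0. Qed.

Definition induced_subgraph : wgraph R T := WGraph iadj_sym iadj_irr iwt_sym iwt_gt0.

End Induced.

Section Hierarchy.
Variables (R : realType) (V : finType) (G : wgraph R V).

Definition strong_sparse_partition (Delta alpha : R) (tau : nat)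
    (P : {set {set V}}) : Prop :=
  [/\ finset.partition P [set: V]%SET,
      forall C : {set V}, C \in P -> (gdiam (induced_subgraph G C) <= Delta%:E)%E
    & forall v : V,
        (#|[set C in P | ~~ [disjoint C & gball G v (Delta / alpha)]]%SET|
           <= tau)%N].

Definition coarsens (Q P : {set {set V}}) : Prop :=
  forall U, U \in P -> exists2 U', U' \in Q & U \subset U'.

(* Only the values C 0, ..., C k matter. *)
Definition strong_sparse_hierarchy (gamma alpha : R) (tau k : nat)
    (C : nat -> {set {set V}}) : Prop :=
  [/\ C 0%N = [set [set v] | v : V]%SET,
      C k = [set [set: V]]%SET,
      forall i, (i <= k)%N ->
        strong_sparse_partition (gamma ^+ i) alpha tau (C i)
    & forall i, (i < k)%N -> coarsens (C i.+1) (C i)].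

End Hierarchy.

(* The bound denoted by soft-O of d ^ k, with universal constant K. *)
Definition softO_bound (R : realType) (K k : nat) (d : R) : R :=
  K%:R * d ^+ k * (1 + ln d) ^+ K.

(* Main.v *)
(* A partition whose clusters have strong diameter r is coarsened as follows.
   Let ell be about the doubling dimension, T about ell * log ell, Q = 3 * ell + 1
   and M = 24 * T ^ 2 * r. Every point t of a net N of scale Q * M gets a shift
   delta t, equal to M times the number of leading heads among Q coins. Put
   g x = min_t (d x t - delta t). Since leading heads are memoryless, the local
   lemma gives coins such that, at every x, only O(ell * log ell) net points come
   within 3 * M / 8 of the minimum. So the coarser partition is sparse as soon as
   every cluster is sent to a net point that is optimal up to M / 4; the difficulty
   is to do this for whole clusters while keeping every part strongly connected.

   Clusters are assigned in T rounds. In a round every net point receives a fresh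
   bonus of 4 * r times a number of leading heads, and a cluster joins t if, at one
   of its vertices, t beats all other net points by 2 * r. Here net points compete
   along walks through unassigned clusters that end in a cluster assigned
   earlier, or in the net point itself. The margin persists along the walk, so all
   clusters that it visits join t in the same round: no part is disconnected, and
   a round lengthens walks by O(T * r) only. A given cluster survives a round with
   probability at most 1/2 whatever happened before, and its fate depends only on
   coins within distance O(T * Q * M); so by the local lemma some coins
   assign all clusters. *)

Require Import Defs.
From mathcomp Require Import all_boot all_order all_algebra.
From mathcomp Require Import all_classical all_reals all_analysis.
(* finset is imported again to take precedence over classical_sets. *)
From mathcomp Require Import fintype finset zify ring lra.

Set Implicit Arguments.
Unset Strict Implicit.
Unset Printing Implicit Defensive.

Import Order.TTheory GRing.Theory Num.Theory.

(** * The local lemma *)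

Section LocalLemma.
Variables (X J : finType).
Local Notation Omega := {ffun X -> bool}.
Implicit Types (A B : {set Omega}) (U : {set X}) (S : {set J}) (f h : Omega).

Definition depends_on U A :=
  forall f h, (forall x, x \in U -> f x = h x) -> (f \in A) = (h \in A).

Definition splice U f h : Omega := [ffun x => if x \in U then f x else h x].

(** Swapping the coordinates outside [U] between the two members of a pair is an involution that
    maps [(A :&: B) x Omega] into [A x B]. *)
Lemma card_setI_indep U A B : depends_on U A -> depends_on (~: U) B ->
  #|A :&: B| * #|[set: Omega]| <= #|A| * #|B|.
Proof.
move=> hA hB; rewrite -!cardsX.
pose F (p : Omega * Omega) := (splice U p.1 p.2, splice U p.2 p.1).
have FK : involutive F.
  by case=> f h; congr (_, _); apply/ffunP => x; rewrite !ffunE; case: ifP => xU; rewrite ?xU.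
rewrite -(card_imset _ (inv_inj FK)); apply/subset_leq_card/subsetP => _ /imsetP[[f h] + ->].
rewrite !inE /= andbT => /andP[fA fB]; apply/andP; split.
  by rewrite (hA _ f) // => x xU; rewrite ffunE xU.
by rewrite (hB _ f) // => x; rewrite inE => /negbTE xU; rewrite ffunE xU.
Qed.

Variables (E : J -> {set Omega}) (vb : J -> {set X}) (D : nat).
Hypothesis Evb : forall i, depends_on (vb i) (E i).
Hypothesis D_gt0 : 0 < D.
Hypothesis degD : forall i, #|[set j | ~~ [disjoint vb i & vb j]]| <= D.
Hypothesis cardE : forall i, 4 * D * #|E i| <= #|[set: Omega]|.

Let avoid S : {set Omega} := [set f | [forall j in S, f \notin E j]].

Let avoidS S S' : S' \subset S -> avoid S \subset avoid S'.
Proof.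
move=> /subsetP sS; apply/subsetP => f; rewrite !inE => /forall_inP h.
by apply/forall_inP => j /sS /h.
Qed.

Let avoid_dep U S : (forall j, j \in S -> [disjoint U & vb j]) ->
  depends_on (~: U) (avoid S).
Proof.
move=> dS f h fh; rewrite !inE; apply: eq_forallb_in => j jS.
congr (~~ _); apply: Evb => x xj; apply: fh; rewrite inE.
by have := dS _ jS; rewrite disjoint_sym => /disjointFr ->.
Qed.

(** Conditionally on avoiding any family [S], each event has probability at most [1 / (2 * D)];
    products replace quotients. Positivity is carried along in the same induction on [#|S|]. *)
Let avoid_bound S : 0 < #|avoid S| /\ forall i, 2 * D * #|E i :&: avoid S| <= #|avoid S|.
Proof.
have [n] := ubnP #|S|; elim: n S => // n IH S; rewrite ltnS => cS.
split.
  have [->|[j jS]] := set_0Vmem S.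
    apply/card_gt0P; exists [ffun=> false]; rewrite inE.
    by apply/forall_inP => j; rewrite inE.
  have [|av_gt0 /(_ j) hj] := IH (S :\ j).
    by move: cS; rewrite (cardsD1 j S) jS.
  have sub : avoid (S :\ j) \subset avoid S :|: (E j :&: avoid (S :\ j)).
    apply/subsetP => f fS; rewrite in_setU in_setI fS andbT.
    case: (boolP (f \in E j)) => fj; first by rewrite orbT.
    rewrite orbF inE; apply/forall_inP => i iS; have [->//|ij] := eqVneq i j.
    by move: fS; rewrite inE => /forall_inP; apply; rewrite !inE ij.
  have := leq_trans (subset_leq_card sub) (leq_card_setU _ _); nia.
(* [S1] holds the at most [D] events of [S] that share a coin with [E i]. By induction each costs at
   most [1 / (2 * D)] given that [S2] is avoided, so avoiding [S1] as well loses at most half;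
   avoiding [S2] is independent of [E i]. *)
move=> i; pose S1 := S :&: [set j | ~~ [disjoint vb i & vb j]]; pose S2 := S :\: S1.
have S2E : forall j, j \in S2 -> [disjoint vb i & vb j].
  by move=> j; rewrite !inE => /andP[+ jS]; rewrite jS /= negbK.
have half : #|avoid S2| <= 2 * #|avoid S|.
  have [S10|[j0 j0S]] := set_0Vmem S1; first by rewrite /S2 S10 setD0; lia.
  have [|_ IH2] := IH S2.
    apply: leq_trans cS; apply: proper_card; apply/properP; split; first exact: subsetDl.
    by exists j0; [move: j0S; rewrite !inE => /andP[]|rewrite inE j0S].
  have sub : avoid S2 \subset avoid S :|: \bigcup_(j in S1) (E j :&: avoid S2).
    apply/subsetP => f fS; rewrite in_setU; have [//|/=] := boolP (f \in avoid S).
    rewrite inE negb_forall_in => /exists_inP[j jS]; rewrite negbK => fj.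
    apply/bigcupP; exists j; last by rewrite inE fj.
    apply/negPn/negP => jS1; move: (fS); rewrite inE => /forall_inP /(_ j).
    by rewrite inE jS jS1 fj => /(_ isT).
  have c1 : #|\bigcup_(j in S1) (E j :&: avoid S2)| <= \sum_(j in S1) #|E j :&: avoid S2|.
    elim/big_rec2: _ => [|j m U _ h]; first by rewrite cards0.
    by rewrite (leq_trans (leq_card_setU _ _)) // leq_add2l.
  have c2 : 2 * D * \sum_(j in S1) #|E j :&: avoid S2| <= D * #|avoid S2|.
    rewrite big_distrr /=; apply: (@leq_trans (\sum_(j in S1) #|avoid S2|)).
      by apply: leq_sum => j _; apply: IH2.
    rewrite sum_nat_const leq_mul2r; apply/orP; right; apply: leq_trans (degD i).
    exact/subset_leq_card/subsetIr.
  have := leq_trans (subset_leq_card sub) (leq_card_setU _ _).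
  have : 2 * \sum_(j in S1) #|E j :&: avoid S2| <= #|avoid S2| by nia.
  lia.
have ind := card_setI_indep (@Evb i) (avoid_dep S2E).
have sub : #|E i :&: avoid S| <= #|E i :&: avoid S2|.
  by apply/subset_leq_card/setIS/avoidS/subsetDl.
have O0 : 0 < #|[set: Omega]| by apply/card_gt0P; exists [ffun=> false]; rewrite inE.
have : 4 * D * #|E i :&: avoid S2| <= #|avoid S2|.
  rewrite -(leq_pmul2r O0); apply: (@leq_trans (4 * D * #|E i| * #|avoid S2|)).
    by rewrite -!mulnA !leq_mul2l ind !orbT.
  by rewrite [leqRHS]mulnC leq_mul2r cardE orbT.
nia.
Qed.

Lemma lovasz_local_lemma : exists f, forall i, f \notin E i.
Proof.
have [/card_gt0P[f]] := avoid_bound setT; rewrite inE => /forall_inP h _.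
by exists f => i; apply: h.
Qed.

End LocalLemma.

(** * Counting coin sequences with prescribed coordinates *)

Section Cylinders.
Variable X : finType.
Local Notation Omega := {ffun X -> bool}.
Implicit Types (A : {set Omega}) (f h : Omega).

(* The fibres of "reset the coordinates W f to b" over the points of A have at
   least 2 ^ n elements each. *)
Lemma card_frozen (b : bool) (n : nat) (W : Omega -> {set X}) A :
  (forall f, f \in A -> n <= #|W f|) ->
  (forall f x, f \in A -> x \in W f -> f x = b) ->
  (forall f h, f \in A -> (forall x, x \notin W f -> h x = f x) -> W h = W f) ->
  #|A| * 2 ^ n <= #|[set: Omega]|.
Proof.
move=> cW fW WE.
pose reset h : Omega := [ffun x => if x \in W h then b else h x].
pose fib f := [set h : Omega | [forall x, (x \notin W f) ==> (h x == f x)]].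
have fibP f h : reflect (forall x, x \notin W f -> h x = f x) (h \in fib f).
  rewrite inE; apply: (iffP forallP) => H x; last by apply/implyP => /H ->.
  by have /implyP := H x => + /[dup] xW => /(_ xW)/eqP.
have resetE f h : f \in A -> h \in fib f -> reset h = f.
  move=> fA /fibP hf; apply/ffunP => x; rewrite ffunE (WE f h fA hf).
  by case: ifPn => [xW|/hf//]; rewrite (fW f x).
have cfib f : f \in A -> 2 ^ n <= #|fib f|.
  move=> fA; pose F (U : {set X}) : Omega := [ffun x => if x \in W f then x \in U else f x].
  apply: (@leq_trans #|powerset (W f)|); first by rewrite card_powerset leq_exp2l // cW.
  rewrite -(card_in_imset (f := F)).
    apply/subset_leq_card/subsetP => _ /imsetP[U _ ->]; apply/fibP => x /negbTE xW.
    by rewrite ffunE xW.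
  move=> U U'; rewrite !powersetE => /subsetP sU /subsetP sU' /ffunP FE.
  apply/setP => x; have := FE x; rewrite !ffunE; case: ifPn => // xW _.
  by apply/idP/idP => [/sU|/sU']; rewrite (negbTE xW).
rewrite -sum_nat_const; apply: (@leq_trans (\sum_(f in A) #|fib f|)).
  exact: leq_sum.
have -> : \sum_(f in A) #|fib f| = \sum_(f in A) \sum_(h in fib f) 1.
  by apply: eq_bigr => f _; rewrite sum1_card.
rewrite pair_big_dep /= sum1dep_card.
rewrite -(card_in_imset (f := snd)); first exact/subset_leq_card/subsetT.
move=> [f h] [f' h']; rewrite !inE /= => /andP[fA +] /andP[f'A +] hh.
by rewrite -{}hh => fh fh'; rewrite -(resetE f h) ?(resetE f' h) // inE.
Qed.

Lemma card_all_heads (W : {set X}) :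
  #|[set f : Omega | [forall x in W, f x]]| * 2 ^ #|W| <= #|[set: Omega]|.
Proof.
apply: (@card_frozen true _ (fun=> W)) => // f x.
by rewrite inE => /forall_inP /(_ x).
Qed.

End Cylinders.

(** * Shortest-path distances and walks inside clusters *)

Section Distances.
Local Open Scope ring_scope.
Variables (R : realType) (V : finType) (G : wgraph R V).
Implicit Types (x y z : V) (p q : seq V) (C : pred V).

Lemma walk_weight_ge0 x p : path (adj G) x p -> 0 <= walk_weight G x p.
Proof.
elim: p x => //= y p IH x /andP[xy /IH h].
by rewrite addr_ge0 // ltW // wt_gt0.
Qed.

Lemma walk_weight_cat x p q :
  walk_weight G x (p ++ q) = walk_weight G x p + walk_weight G (last x p) q.
Proof. by elim: p x => [|y p IH] x /=; rewrite ?add0r // IH addrA. Qed.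

Lemma uniq_walk x p : path (adj G) x p ->
  exists q, [/\ path (adj G) x q, last x q = last x p, uniq (x :: q) &
                walk_weight G x q <= walk_weight G x p].
Proof.
elim: p x => [|y p IH] x /=; first by move=> _; exists [::].
move=> /andP[xy /IH[q [pq lq uq wq]]].
have [xq|xq] := boolP (x \in y :: q); last first.
  exists (y :: q); split => //=; rewrite ?xy ?pq //.
    by move: xq uq; rewrite /= => -> ->.
  by rewrite lerD2l.
move: xq; rewrite inE => /predU1P[xy'|xq].
  by move: xy; rewrite xy' adj_irr.
case/splitPr: xq pq lq uq wq => q1 q2; rewrite cat_path /= => /and3P[pq1 axq pq2].
rewrite last_cat /= walk_weight_cat cat_uniq /= => lq /and4P[_ _ _ uq] wq.
exists q2; split => //.
have := wt_gt0 xy; have := walk_weight_ge0 pq1; have /= := wt_gt0 axq; lra.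
Qed.

(** Cutting loops never lengthens a walk, so the infimum is a minimum over the finite type of walks
    with at most [#|V|] steps. *)
Lemma gdist_attained x y : connect (adj G) x y ->
  exists2 p, path (adj G) x p /\ last x p = y & gdist G x y = (walk_weight G x p)%:E.
Proof.
move=> /connectP[p0 pp0 lp0]; have [q0 [pq0 lq0 uq0 _]] := uniq_walk pp0.
have sz q : uniq (x :: q) -> (size q <= #|V|)%N.
  by move=> /card_uniqP uq; apply: ltnW; rewrite -[(size q).+1]uq max_card.
pose P (q : #|V|.-bseq V) := path (adj G) x q && (last x q == y).
have P0 : P (Bseq (sz _ uq0)) by rewrite /P /= pq0 lq0 -lp0 eqxx.
case: (arg_minP (fun q : #|V|.-bseq V => walk_weight G x q) P0) => q /andP[pq /eqP lq] qmin.
exists (val q) => //; apply/eqP; rewrite eq_le; apply/andP; split.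
  by apply: ereal_inf_lbound; exists (val q).
apply: le_ereal_inf_tmp => _ [p /= [pp lp] <-]; rewrite lee_fin.
have [r [pr lr ur /(le_trans _)]] := uniq_walk pp; apply.
by apply: (qmin (Bseq (sz _ ur))); rewrite /P /= pr lr lp eqxx.
Qed.

Definition dist x y : R := fine (gdist G x y).

Hypothesis connG : wconnected G.

Lemma gdistE x y : gdist G x y = (dist x y)%:E.
Proof. by have [p _] := gdist_attained (connG x y); rewrite /dist => ->. Qed.

Lemma gballE u v r : (u \in gball G v r) = (dist u v <= r).
Proof. by rewrite inE gdistE lee_fin. Qed.

Lemma dist_le_walk x p : path (adj G) x p -> dist x (last x p) <= walk_weight G x p.
Proof. by move=> pp; rewrite -lee_fin -gdistE; apply: ereal_inf_lbound; exists p. Qed.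

Lemma dist_geodesic x y : exists p,
  [/\ path (adj G) x p, last x p = y & dist x y = walk_weight G x p].
Proof.
by have [p [pp lp] e] := gdist_attained (connG x y); exists p; rewrite /dist e.
Qed.

Lemma dist_ge0 x y : 0 <= dist x y.
Proof. by have [p [pp _ ->]] := dist_geodesic x y; apply: walk_weight_ge0. Qed.

Lemma distxx x : dist x x = 0.
Proof.
by apply/eqP; rewrite eq_le dist_ge0 andbT; apply: (@dist_le_walk x [::]).
Qed.

Lemma dist_triangle y x z : dist x z <= dist x y + dist y z.
Proof.
have [p [pp lp ->]] := dist_geodesic x y; have [q [pq lq ->]] := dist_geodesic y z.
have := @dist_le_walk x (p ++ q).
by rewrite cat_path pp lp pq last_cat lp lq walk_weight_cat lp; apply.
Qed.

Lemma dist_adj x y : adj G x y -> dist x y <= wt G x y.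
Proof. by move=> xy; have := @dist_le_walk x [:: y]; rewrite /= xy addr0; apply. Qed.

Lemma dist_le_sym x y : dist y x <= dist x y.
Proof.
have [p [pp lp ->]] := dist_geodesic x y.
elim: p x pp lp => [x _ /= <-|z p IH x /= /andP[xz pz] lp]; first by rewrite distxx.
apply: le_trans (dist_triangle z _ _) _; rewrite addrC lerD ?IH //.
by rewrite wt_sym // dist_adj // adj_sym.
Qed.

Lemma distC x y : dist x y = dist y x.
Proof. by apply/eqP; rewrite eq_le !dist_le_sym. Qed.

Hypothesis minG : min_dist_one G.

Lemma dist_ge1 x y : x != y -> 1 <= dist x y.
Proof. by case: minG => h _ /h; rewrite gdistE lee_fin. Qed.

Lemma dist_eq1 : exists x y, x != y /\ dist x y = 1.
Proof. by case: minG => _ [x [y [xy]]]; rewrite gdistE => -[e]; exists x, y. Qed.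

End Distances.

(** * Walks of bounded length inside a vertex set *)

Section Reach.
Local Open Scope ring_scope.
Variables (R : realType) (V : finType) (G : wgraph R V).
Implicit Types (x y z : V) (C D : pred V) (w : R).

(** The number is a budget: [reach_refl] absorbs any slack. The walks live in [V] rather than in an
    induced subgraph, so that they can be concatenated and carried over to larger sets. *)
Inductive reach C : V -> V -> R -> Prop :=
| reach_refl x w : C x -> 0 <= w -> reach C x x w
| reach_step x y z w : C x -> adj G x z -> reach C z y w -> reach C x y (wt G x z + w).

Lemma reach_weaken C x y w w' : w <= w' -> reach C x y w -> reach C x y w'.
Proof.
move=> + h; elim: h w' => {x y w} [x w Cx w0 w' ww'|x y z w Cx xz h IH w' ww'].
  by apply: reach_refl => //; apply: le_trans ww'.
rewrite -[w'](subrKC (wt G x z)); apply: reach_step => //; apply: IH; lra.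
Qed.

Lemma reach_subpred C D x y w : subpred C D -> reach C x y w -> reach D x y w.
Proof.
move=> sub; elim=> {x y w} [x w /sub Dx w0|x y z w /sub Dx xz _ IH].
  exact: reach_refl.
exact: reach_step.
Qed.

Lemma reach_end C x y w : reach C x y w -> C y.
Proof. by elim. Qed.

Lemma reach_start C x y w : reach C x y w -> C x.
Proof. by case. Qed.

Lemma reach_trans C y x z w w' :
  reach C x y w -> reach C y z w' -> reach C x z (w + w').
Proof.
elim=> {x y w} [x w Cx w0|x y u w Cx xu _ IH /IH]; first by apply: reach_weaken; lra.
by rewrite -addrA; apply: reach_step.
Qed.

Lemma reach_sym C x y w : reach C x y w -> reach C y x w.
Proof.
elim=> {x y w} [x w Cx w0|x y z w Cx xz h IH]; first exact: reach_refl.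
rewrite addrC; apply: reach_trans IH _; rewrite -[X in reach _ _ _ X]addr0.
rewrite wt_sym //; apply: reach_step; last exact: reach_refl.
  exact: reach_start h.
by rewrite adj_sym.
Qed.

Lemma dist_le_reach C x y w : wconnected G -> reach C x y w -> dist G x y <= w.
Proof.
move=> cG; elim=> {x y w} [x w _ w0|x y z w _ xz _ IH]; first by rewrite distxx.
by apply: le_trans (dist_triangle cG z x y) _; rewrite lerD // dist_adj.
Qed.

Lemma gdist_induced_le (C : {set V}) x y w (xC : x \in C) (yC : y \in C) :
  reach (mem C) x y w ->
  (gdist (induced_subgraph G C) (exist _ x xC) (exist _ y yC) <= w%:E)%E.
Proof.
move=> h; suff [p [pp lp wp]] : exists p : seq {x : V | x \in C},
    [/\ path (adj (induced_subgraph G C)) (exist _ x xC) p,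
        last (exist _ x xC) p = exist _ y yC &
        walk_weight (induced_subgraph G C) (exist _ x xC) p <= w].
  by apply: le_trans (_ : _ <= (walk_weight _ _ p)%:E)%E _;
    [apply: ereal_inf_lbound; exists p|rewrite lee_fin].
elim: h xC yC => {x y w} [x w _ w0 xC yC|x y z w _ xz h IH xC yC].
  by exists [::]; split => //; apply: val_inj.
have zC : z \in C := reach_start h.
have [p [pp lp wp]] := IH zC yC.
by exists (exist _ z zC :: p); split => //=; rewrite ?lerD2l // pp andbT.
Qed.

Lemma gdiam_induced_le (C : {set V}) w :
  {in C &, forall x y, reach (mem C) x y w} -> (gdiam (induced_subgraph G C) <= w%:E)%E.
Proof.
move=> h; apply: ge_ereal_sup => _ [[[x xC] [y yC]] _ <-] /=.
exact/gdist_induced_le/h.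
Qed.

End Reach.

(** * Coverings, packings and nets in doubling metrics *)

Section Packing.
Local Open Scope ring_scope.
Variables (R : realType) (V : finType) (G : wgraph R V).
Hypothesis connG : wconnected G.
Local Notation d := (dist G).
Implicit Types (x y t : V) (A N : {set V}) (rho sigma e : R) (k m : nat).

Lemma leq_card_bigcup (I T : finType) (S : {set I}) (F : I -> {set T}) m :
  (forall i, i \in S -> #|F i| <= m)%N -> (#|\bigcup_(i in S) F i| <= #|S| * m)%N.
Proof.
move=> h; rewrite -sum_nat_const; apply: (@leq_trans (\sum_(i in S) #|F i|)%N).
  elim/big_rec2: _ => [|i n U _ IH]; first by rewrite cards0.
  by rewrite (leq_trans (leq_card_setU _ _)) // leq_add2l.
exact: leq_sum.
Qed.

Section Doubling.
Variable l : nat.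
Hypothesis dblG : has_doubling_constant G l.

Lemma ball_cover k x rho : 0 < rho ->
  exists S : {set V}, (#|S| <= l ^ k)%N /\
    gball G x (2 ^+ k * rho) \subset \bigcup_(s in S) gball G s rho.
Proof.
move=> rho0; elim: k x => [|k IH] x.
  exists [set x]; rewrite cards1 expr0 mul1r; split => //.
  by apply/subsetP => y yx; apply/bigcupP; exists x; rewrite // set11.
have [|S1 [cS1 sS1]] := dblG x (r := 2 ^+ k * rho).
  by rewrite mulr_gt0 // exprn_gt0.
have [F FP] := choice (fun s => IH s).
exists (\bigcup_(s in S1) F s); split.
  rewrite expnS; apply: leq_trans (leq_card_bigcup (m := l ^ k) _) _.
    by move=> s _; case: (FP s).
  by rewrite leq_mul2r cS1 orbT.
rewrite exprS -mulrA; apply/subsetP => y /(subsetP sS1)/bigcupP[s sS ys].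
have [_ /subsetP /(_ _ ys) /bigcupP[u uF yu]] := FP s.
by apply/bigcupP; exists u => //; apply/bigcupP; exists s.
Qed.

(** [f] is meant to be the identity, to count net points, or the centre map of a partition, to count
    the clusters that meet a ball. *)
Lemma card_imset_ball (f : V -> V) A k m x rho sigma : 0 < rho ->
  (forall y, #|f @: (A :&: gball G y rho)| <= m)%N -> sigma <= 2 ^+ k * rho ->
  (#|f @: (A :&: gball G x sigma)| <= m * l ^ k)%N.
Proof.
move=> rho0 hm hs; have [S [cS sS]] := ball_cover k x rho0.
have sub : f @: (A :&: gball G x sigma) \subset
    \bigcup_(s in S) f @: (A :&: gball G s rho).
  apply/subsetP => _ /imsetP[y + ->]; rewrite in_setI => /andP[yA yx].
  have /(subsetP sS)/bigcupP[s s_in ys] : y \in gball G x (2 ^+ k * rho).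
    by move: yx; rewrite !gballE // => /le_trans; apply.
  by apply/bigcupP; exists s => //; apply: imset_f; rewrite in_setI yA.
apply: leq_trans (subset_leq_card sub) _.
apply: leq_trans (leq_card_bigcup (m := m) _) _ => //.
by rewrite mulnC leq_mul2l cS orbT.
Qed.

(** A ball of radius [e / 2] contains at most one point of an [e]-separated set. *)
Lemma card_separated_ball N e k x sigma : 0 < e ->
  {in N &, forall t t', t != t' -> e < d t t'} -> sigma <= 2 ^+ k * (e / 2) ->
  (#|N :&: gball G x sigma| <= l ^ k)%N.
Proof.
move=> e0 sepN hs; have := @card_imset_ball id N k 1 x (e / 2) sigma.
rewrite imset_id mul1n; apply => //; first by rewrite divr_gt0.
move=> y; rewrite imset_id; apply/card_le1P => t; rewrite in_setI => /andP[tN].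
rewrite gballE // => ty t'; rewrite in_setI gballE // inE.
apply/andP/eqP => [[t'N t'y]|->//]; apply/eqP/negPn/negP => tt'.
have := sepN _ _ t'N tN tt'; have := dist_triangle connG y t' t.
by rewrite (distC connG y); lra.
Qed.

End Doubling.

(** A maximal [e]-separated set also covers, since a point farther than [e] from it could be
    added. *)
Lemma net_exists e : 0 < e -> exists N : {set V},
  (forall x, exists2 t, t \in N & d x t <= e) /\
  {in N &, forall t t', t != t' -> e < d t t'}.
Proof.
move=> e0; pose P A := [forall t in A, forall t' in A, (t != t') ==> (e < d t t')].
have P0 : P set0 by apply/forall_inP => t; rewrite inE.
have [N /maxsetP[PN maxN] _] := maxset_exists P0.
have sepN : {in N &, forall t t', t != t' -> e < d t t'}.
  by move=> t t' tN t'N; move/forall_inP: PN => /(_ t tN)/forall_inP/(_ t' t'N)/implyP.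
exists N; split => // x; apply: contrapT => hx.
have far t : t \in N -> e < d x t.
  by move=> tN; rewrite ltNge; apply/negP => dt; apply: hx; exists t.
have PxN : P (x |: N).
  apply/forall_inP => t tx; apply/forall_inP => t' t'x; apply/implyP.
  move: tx t'x; rewrite !inE => /predU1P[->|tN] /predU1P[->|t'N].
  - by rewrite eqxx.
  - by move=> _; apply: far.
  - by move=> _; rewrite distC // far.
  - exact: sepN.
have xN : x \in N by rewrite -(maxN _ PxN (subsetUr _ _)) setU11.
by have := far _ xN; rewrite distxx //; lra.
Qed.

End Packing.

(** * Random shifts *)

Section LeadingHeads.
Implicit Types (f g : nat -> bool) (n m l : nat).

(** [find] returns [n] if there is no tail: this is a geometric variable truncated at [n]. *)
Definition lead f n := find (fun l => ~~ f l) (iota 0 n).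

Lemma lead_le f n : lead f n <= n.
Proof. by rewrite /lead -[leqRHS](size_iota 0) find_size. Qed.

Lemma lead_head f n l : l < lead f n -> f l.
Proof.
move=> lf; have := before_find 0 lf; rewrite nth_iota ?add0n; last first.
  exact: leq_trans lf (lead_le f n).
by move/negbFE.
Qed.

Lemma lead_tail f n : lead f n < n -> f (lead f n) = false.
Proof.
move=> lf; have : has (fun l => ~~ f l) (iota 0 n) by rewrite has_find size_iota.
by move/(nth_find 0); rewrite nth_iota ?add0n // => /negbTE.
Qed.

Lemma lead_ge f n m : m <= n -> (forall l, l < m -> f l) -> m <= lead f n.
Proof.
move=> mn h; rewrite leqNgt; apply/negP => lm.
by have := h _ lm; rewrite lead_tail // (leq_trans lm).
Qed.

Lemma eq_lead f g n : (forall l, l < n -> f l = g l) -> lead f n = lead g n.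
Proof.
move=> fg; apply: eq_in_find => l; rewrite mem_iota add0n => /fg -> //.
Qed.

Lemma leq_expl n m k : n <= m -> n ^ k <= m ^ k.
Proof. by case: k => // k nm; rewrite leq_exp2r. Qed.

Lemma bin_le_exp n k : 'C(n, k) <= n ^ k.
Proof.
elim: n k => [|n IH] [|k] //; rewrite ?bin0 // binS.
apply: (@leq_trans (n ^ k.+1 + n ^ k)); first by rewrite leq_add.
by rewrite expnS -mulSnr expnS leq_mul2l leq_expl ?leqnSn ?orbT.
Qed.

End LeadingHeads.

(** * Shifts for which few net points are almost optimal *)

Section SparseShifts.
Local Open Scope ring_scope.
Variables (R : realType) (V : finType) (G : wgraph R V).
Hypothesis connG : wconnected G.
Local Notation d := (dist G).
Variables (lam ell k kA Q : nat).
Hypothesis QE : Q = (3 * ell).+1.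
Hypothesis dblG : has_doubling_constant G lam.
Hypothesis lam_le : (lam <= 2 ^ ell)%N.
Hypothesis kA_ge : (256 * Q <= 2 ^ kA)%N.
Hypothesis k_ge : (4 * (2 ^ (ell * kA) * (4 * Q + 5)) <= 2 ^ k)%N.
Variable M : R.
Hypothesis M_gt0 : 0 < M.

Local Notation X := (V * 'I_Q.+1)%type.
Local Notation Omega := {ffun X -> bool}.
Let coin (f : Omega) (t : V) (i : nat) : bool := f (t, inord i).
Let q (f : Omega) (t : V) : nat := lead (coin f t) Q.
Let score (f : Omega) (v t : V) : R := M * (q f t)%:R - d v t.

Variables N N' : {set V}.
Hypothesis covN : forall x, exists2 t, t \in N & d x t <= Q%:R * M.
Hypothesis sepN : {in N &, forall t t', t != t' -> Q%:R * M < d t t'}.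
Hypothesis covN' : forall x, exists2 t, t \in N' & d x t <= M / 16.
Hypothesis sepN' : {in N' &, forall t t', t != t' -> M / 16 < d t t'}.

(** Some net point has score at least [- Q * M] at [v]. Hence one within [M / 2] of the maximum lies
    at distance at most [2 * Q * M + M / 2], inside this ball. *)
Let near v := locked (N :&: gball G v (4 * Q%:R * M)).
Let in_near v t : (t \in near v) = (t \in N) && (d t v <= 4 * Q%:R * M).
Proof. by rewrite /near -lock in_setI gballE. Qed.
(** Windows of length [M] start every [M / 2]. So for a maximal score [m] between [- Q * M] and
    [Q * M], some window contains all of [m - M / 2] to [m]. *)
Let lvl (j : nat) : R := (j%:R / 2 - Q%:R - 1) * M.
(* At most one i satisfies lvl j <= M * i - d v t < lvl j + M. If t is near v and has
   a score in this window, then q f t is that i, so coin i of t shows a tail; whether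
   coin i is reached depends only on the previous coins of t. *)
Let crowded v (j : 'I_(4 * Q + 4)) : {set Omega} :=
  [set f | [forall t in near v, score f v t < lvl j + M] &&
     (k <= #|[set t in near v | (lvl j <= score f v t)%R && (q f t < Q)%N]|)%N].
Let capped v : {set Omega} := [set f | (k <= #|[set t in near v | q f t == Q]|)%N].

Let QM_gt0 : 0 < Q%:R * M. Proof. by rewrite mulr_gt0 // QE ltr0n. Qed.
Let Q_ge1 : 1 <= Q%:R :> R. Proof. by rewrite QE ler1n. Qed.

Let card_near v : (#|near v| <= 2 ^ (ell * 3))%N.
Proof.
rewrite /near -lock; apply: leq_trans (card_separated_ball (k := 3) (e := Q%:R * M) connG dblG _ _ _ _) _ => //.
  have -> : 2 ^+ 3 * (Q%:R * M / 2) = 4 * Q%:R * M by field.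
  exact: lexx.
by rewrite expnM leq_expl.
Qed.

Let eq_q (f h : Omega) t : (forall i, f (t, i) = h (t, i)) -> q f t = q h t.
Proof. by move=> fh; apply: eq_lead => i _; rewrite /coin fh. Qed.

Let card_crowded v j : (#|crowded v j| * 2 ^ k <= #|[set: Omega]|)%N.
Proof.
pose win (p : X) := [&& p.1 \in near v, (p.2 < Q)%N, lvl j <= M * p.2%:R - d v p.1
                      & M * p.2%:R - d v p.1 < lvl j + M].
(* [W f] consists of the window coins that are reached. A head there would lift the score to
   [lvl j + M] or beyond, so on the event all of them are tails, and there are at least [k]. *)
pose W f : {set X} := [set p : X | win p && [forall i : 'I_Q.+1, (i < p.2)%N ==> f (p.1, i)]].
apply: (@card_frozen X false k W).
- move=> f; rewrite inE => /andP[/forall_inP lt_f kf]; apply: leq_trans kf _.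
  pose F t : X := (t, inord (q f t)).
  rewrite -(card_imset (f := F)); last by move=> t t' [].
  apply/subset_leq_card/subsetP => _ /imsetP[t + ->]; rewrite !inE.
  move=> /and3P[tv ge_t qt].
  have qE : (inord (q f t) : 'I_Q.+1) = q f t :> nat by rewrite inordK // ltnS ltnW.
  rewrite /win /= qE tv qt ge_t /=; apply/andP; split; first exact: lt_f.
  by apply/forallP => i; apply/implyP => /lead_head; rewrite /coin inord_val.
- move=> f [t i]; rewrite !inE /= => /andP[/forall_inP lt_f _].
  move=> /andP[/and4P[/= tv iQ ge_i _] /forallP h]; apply/negP => fi.
  have : (i.+1 <= q f t)%N.
    apply: lead_ge => // a; rewrite ltnS leq_eqVlt => /predU1P[->|ai].
      by rewrite /coin inord_val.
    have /implyP := h (inord a); rewrite inordK; first by apply.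
    by rewrite (leq_trans ai) // ltnW.
  rewrite -(ler_nat R) -natr1 => qi.
  have := lt_f _ tv; rewrite /score; have : M * (i%:R + 1) <= M * (q f t)%:R by rewrite ler_pM2l.
  lra.
- move=> f h _ fh; apply/setP => -[t i]; rewrite !inE; case: (boolP (win _)) => //= wi.
  apply: eq_forallb => a; case: (ltnP a i) => //= ai; apply: fh.
  rewrite inE negb_and; apply/orP; left; apply/negP; move: wi.
  move=> /and4P[/= _ _ _ lt_i] /and4P[/= _ _ ge_a _].
  have : M * (a%:R + 1) <= M * i%:R by rewrite ler_pM2l // natr1 ler_nat.
  lra.
Qed.

(** Union bound over the sets of [k] points of [near v]: there are at most [2 ^ (3 * ell * k)] of
    them, and each shows [k * Q] heads with probability [2 ^ - (k * Q)]. The choice of [Q] leaves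
    [2 ^ - k]. *)
Let card_capped v : (#|capped v| * 2 ^ k <= #|[set: Omega]|)%N.
Proof.
pose H (A : {set V}) : {set X} := [set p : X | (p.1 \in A) && (p.2 < Q)%N].
have cH (A : {set V}) : #|H A| = (#|A| * Q)%N.
  have -> : H A = setX A (lift ord_max @: [set: 'I_Q]).
    apply/setP => -[t i]; rewrite !inE /=; case: (t \in A) => //=.
    apply/idP/imsetP => [iQ|[a _ ->]].
      exists (Ordinal iQ); rewrite ?inE //; apply: val_inj.
      by rewrite [RHS]lift_max.
    by rewrite lift_max ltn_ord.
  by rewrite cardsX card_imset ?cardsT ?card_ord //; apply: lift_inj.
pose draws := [set A : {set V} | A \subset near v & #|A| == k].
have sub : capped v \subset \bigcup_(A in draws) [set f : Omega | [forall p in H A, f p]].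
  apply/subsetP => f; rewrite inE => /card_geqP[s [us ss sv]].
  apply/bigcupP; exists [set x in s]; rewrite !inE.
    rewrite cardsE (card_uniqP us) ss eqxx andbT.
    by apply/subsetP => x; rewrite inE => /sv; rewrite inE => /andP[].
  apply/forall_inP => -[t i]; rewrite !inE /= => /andP[/sv]; rewrite inE => /andP[_ /eqP qt] iQ.
  by have := @lead_head (coin f t) Q i; rewrite -/(q f t) qt /coin inord_val; apply.
have h : (#|capped v| * 2 ^ (k * Q) <= 2 ^ (ell * 3 * k) * #|[set: Omega]|)%N.
  apply: leq_trans (_ : (\sum_(A in draws) #|[set: Omega]| <= _)%N).
    apply: (@leq_trans ((\sum_(A in draws) #|[set f : Omega | [forall p in H A, f p]]|)
                          * 2 ^ (k * Q))).
      rewrite leq_mul2r; apply/orP; right; apply: leq_trans (subset_leq_card sub) _.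
      elim/big_rec2: _ => [|A n U _ IH]; first by rewrite cards0.
      by rewrite (leq_trans (leq_card_setU _ _)) // leq_add2l.
    rewrite big_distrl; apply: leq_sum => A /=; rewrite !inE => /andP[_ /eqP <-].
    by rewrite -cH card_all_heads.
  rewrite sum_nat_const leq_mul2r; apply/orP; right.
  by rewrite cards_draws (leq_trans (bin_le_exp _ _)) // expnM leq_expl ?card_near.
move: h; have -> : (k * Q = ell * 3 * k + k)%N by rewrite QE; nia.
by rewrite expnD mulnCA leq_pmul2l // expn_gt0.
Qed.

(** Bad events are placed only at the points of the finer net [N'], which bounds their dependencies.
    Moving from [v] to a point of [N'] changes each of two scores by at most [M / 16], which turns
    [3 / 8 * M] into [M / 2]. Fewer than [k] such points are in the window with a tail left, and
    fewer than [k] are capped. *)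
Lemma sparse_shifts : exists q : V -> nat, (forall t, q t <= Q)%N /\
  forall v, (#|[set t in N | [forall t' in N,
     (M * (q t')%:R - d v t' - 3 / 8 * M <= M * (q t)%:R - d v t)%R]]| <= 2 * k)%N.
Proof.
(* [Some j] stands for the window [j] and [None] for the capped event: [4 * Q + 5] events per
   point. *)
pose J := (V * option 'I_(4 * Q + 4))%type.
pose E (i : J) : {set Omega} :=
  if i.1 \in N' then (if i.2 is Some j then crowded i.1 j else capped i.1) else set0.
pose vb (i : J) : {set X} := if i.1 \in N' then [set p : X | p.1 \in near i.1] else set0.
have [||||f fE] := @lovasz_local_lemma X J E vb (2 ^ (ell * kA) * (4 * Q + 5)).
- move=> [v o] f h fh; rewrite /E /=; move: fh; rewrite /vb /=.
  case: (v \in N') => // fh; last by rewrite !inE.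
  have qE t : t \in near v -> q f t = q h t.
    by move=> tv; apply: eq_q => i; apply: fh; rewrite inE.
  case: o => [j|]; rewrite !inE.
    congr (_ && (_ <= _)%N); first by apply: eq_forallb_in => t /qE; rewrite /score => ->.
    apply: eq_card => t; rewrite !inE; case: (boolP (t \in near v)) => //= tv.
    by rewrite /score qE.
  congr (_ <= _)%N; apply: eq_card => t; rewrite !inE.
  by case: (boolP (t \in near v)) => //= tv; rewrite qE.
- by rewrite muln_gt0 expn_gt0 addnS.
- move=> [v o].
  apply: (@leq_trans #|setX (N' :&: gball G v (8 * Q%:R * M)) [set: option 'I_(4 * Q + 4)]|).
    apply/subset_leq_card/subsetP => -[v' o']; rewrite inE /vb /= => vv'.
    rewrite in_setX in_setT andbT in_setI gballE //.
    move: vv'; case: ifP; last by rewrite -setI_eq0 set0I eqxx.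
    case: ifP; last by rewrite -setI_eq0 setI0 eqxx.
    move=> v'N vN; rewrite -setI_eq0 => /set0Pn[[t i]]; rewrite in_setI !in_set.
    rewrite !in_near /= => /andP[/andP[_ tv] /andP[_ tv']].
    have := dist_triangle connG t v' v.
    by rewrite (distC connG v' t); lra.
  rewrite cardsX cardsT card_option card_ord -addnS; apply: leq_mul => //.
  apply: leq_trans (card_separated_ball (k := kA) (e := M / 16) connG dblG _ _ sepN' _) _.
  - by rewrite divr_gt0.
  - have : (256 * Q)%:R <= (2 ^ kA)%:R :> R by rewrite ler_nat.
    rewrite natrX natrM => h.
    have -> : 8 * Q%:R * M = 256%:R * Q%:R * (M / 16 / 2) by field.
    by rewrite ler_wpM2r // !divr_ge0 // ltW.
  - by rewrite expnM leq_expl.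
- move=> [v o]; apply: (@leq_trans (#|E (v, o)| * 2 ^ k)).
    by rewrite mulnC leq_mul2l k_ge orbT.
  rewrite /E /=; case: (v \in N'); last by rewrite cards0.
  by case: o => [j|].
exists (q f); split; first by move=> t; apply: lead_le.
move=> v; have [v' v'N vv'] := covN' v.
have [t0 t0N dt0] := covN v'.
have [ts tsN tsmax] := arg_maxP (score f v') t0N.
have q_le t : (q f t)%:R <= Q%:R :> R by rewrite ler_nat lead_le.
have Mq_le t : M * (q f t)%:R <= Q%:R * M by rewrite mulrC ler_wpM2r // ltW.
set m := score f v' ts.
have m_le : m <= Q%:R * M.
  by have := Mq_le ts; have := dist_ge0 connG v' ts; rewrite /m /score; lra.
have m_ge : - (Q%:R * M) <= m.
  apply: le_trans (tsmax _ t0N); rewrite /score.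
  have : 0 <= M * (q f t0)%:R by rewrite mulr_ge0 // ltW.
  by lra.
(* [z] is the real index whose level is exactly [m - M / 2]; rounding it down lowers the level by
   less than [M / 2]. *)
pose z := 2 * (m / M + Q%:R + 1 / 2).
have z_ge0 : 0 <= z.
  have : - Q%:R <= m / M by rewrite ler_pdivlMr // mulNr.
  by rewrite /z; lra.
have z_lt : z < (4 * Q + 4)%:R.
  have : m / M <= Q%:R by rewrite ler_pdivrMr.
  by rewrite /z natrD natrM; lra.
have /andP[jz zj] := truncn_itv z_ge0; set j := Num.truncn z in jz zj.
have jlt : (j < 4 * Q + 4)%N by rewrite -(ltr_nat R); apply: le_lt_trans z_lt.
have lvl_le : lvl j <= m - M / 2.
  have -> : m - M / 2 = (z / 2 - Q%:R - 1) * M by rewrite /z; field; rewrite gt_eqF.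
  by rewrite ler_pM2r //; lra.
have lt_lvl : m < lvl j + M.
  have -> : m = ((z + 1) / 2 - Q%:R - 1) * M by rewrite /z; field; rewrite gt_eqF.
  have -> : lvl j + M = ((j.+1%:R + 1) / 2 - Q%:R - 1) * M.
    by rewrite /lvl -natr1; field.
  by rewrite ltr_pM2r //; lra.
have notcr : f \notin crowded v' (Ordinal jlt).
  by have := fE (v', Some (Ordinal jlt)); rewrite /E /= v'N.
have notcap : f \notin capped v' by have := fE (v', None); rewrite /E /= v'N.
have c1 : (#|[set t in near v' | (lvl j <= score f v' t)%R & (q f t < Q)%N]| < k)%N.
  move: notcr; rewrite inE negb_and => /orP[/negP[]|]; last by rewrite -ltnNge.
  apply/forall_inP => t; rewrite in_near => /andP[tN _].
  by apply: le_lt_trans (tsmax _ tN) lt_lvl.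
have c2 : (#|[set t in near v' | q f t == Q]| < k)%N by move: notcap; rewrite inE -ltnNge.
apply: (@leq_trans (#|[set t in near v' | (lvl j <= score f v' t)%R & (q f t < Q)%N]| +
                    #|[set t in near v' | q f t == Q]|)); last first.
  by rewrite mul2n -addnn leq_add // ltnW.
apply: leq_trans (leq_card_setU _ _); apply/subset_leq_card/subsetP => t.
rewrite !inE => /andP[tN /forall_inP /(_ ts tsN) ht].
have tm : m - M / 2 <= score f v' t.
  rewrite /m /score; have := dist_triangle connG v v' t; have := dist_triangle connG v' v ts.
  by rewrite (distC connG v' v); lra.
have tv : t \in near v'.
  rewrite in_near tN /= distC //; move: tm; rewrite /score; have := Mq_le t.
  have : 0 <= (Q%:R - 1) * M by rewrite mulr_ge0 // ?subr_ge0 // ltW.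
  by lra.
rewrite tv /= (le_trans lvl_le tm) /= ltn_neqAle lead_le andbT.
by case: eqVneq.
Qed.
End SparseShifts.

(** * Assigning clusters in rounds *)

Section Rounds.
Local Open Scope ring_scope.
Variables (R : realType) (V : finType) (G : wgraph R V).
Hypothesis connG : wconnected G.
Local Notation d := (dist G).
Variables (c : V -> V) (r : R).
Hypothesis r_gt0 : 0 < r.
Hypothesis c_idem : forall x, c (c x) = c x.
Hypothesis c_reach : forall x, reach G [pred z | c z == c x] x (c x) (r / 2).
Variables (N : {set V}) (delta g : V -> R).
Hypothesis g_le : forall x t, t \in N -> g x <= d x t - delta t.
Hypothesis g_attained : forall x, exists2 t, t \in N & g x = d x t - delta t.
Variable T : nat.

Local Notation state := (V -> option (V * nat)).
(** Growth of the walks in one round: up to [4 * r * T] from a bonus, [r] for crossing the cluster,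
    and [r] for the change of [g] across it. *)
Local Notation L := ((4 * T%:R + 2) * r).
Implicit Types (s : state) (t x y z : V) (w : R) (qf : V -> nat).

(* A state maps an assigned vertex to its net point and the round in which it
   joined it. [route s t x w] is a walk of unassigned vertices from x to a source
   of t (a vertex assigned to t, or t itself while unassigned); w is its length
   plus the potential of the source. *)
Inductive route s t : V -> R -> Prop :=
| route_src y i : s y = Some (t, i) -> route s t y (g y + i%:R * L)
| route_own : t \in N -> s t = None -> route s t t (- delta t)
| route_step x z w : s x = None -> adj G x z -> route s t z w -> route s t x (wt G x z + w).

(* A margin of 2 * r survives moving inside a cluster, whose diameter is at most r;
   hence the cores of two net points never meet the same cluster. *)
Definition wins s qf t x w := forall t' w', t' != t -> route s t' x w' ->
  w - 4 * r * (qf t)%:R + 2 * r <= w' - 4 * r * (qf t')%:R.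

Definition core s qf t x := s x = None /\ exists2 w, route s t x w & wins s qf t x w.

(** In a valid state the [pick] involves no choice, by [core_uniq]. Rounds are numbered from 1,
    hence [k.+1]. *)
Definition next_state s qf (k : nat) : state := fun x =>
  if s x is Some o then Some o else
  if [pick t | `[< exists2 x', c x' = c x & core s qf t x' >]] is Some t
  then Some (t, k.+1) else None.

Definition owned s t : pred V := fun z => if s z is Some (t', _) then t' == t else false.

(** In [valid_reach], [g y + delta t] would be the distance to an optimal net point, and [i * L] is
    the excess accumulated in [i] rounds. The walk stays in the part of [t], which controls the
    strong diameter. *)
Record valid s (k : nat) : Prop := Valid {
  valid_cluster : forall x y, c x = c y -> s x = s y;
  valid_round : forall y t i, s y = Some (t, i) -> (i <= k)%N;
  valid_net : forall y t i, s y = Some (t, i) -> t \in N;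
  valid_reach : forall y t i, s y = Some (t, i) ->
    reach G (owned s t) y t (g y + i%:R * L + delta t) }.

Lemma L_ge0 : 0 <= L.
Proof. by rewrite mulr_ge0 ?ltW // addr_ge0 // mulr_ge0. Qed.

Lemma g_adj x z : adj G x z -> g x <= wt G x z + g z.
Proof.
move=> xz; have [t tN ->] := g_attained z; apply: le_trans (g_le x tN) _.
have := dist_triangle connG z x t; have := dist_adj connG xz; lra.
Qed.

Lemma g_reach C x y w : reach G C x y w -> g x <= w + g y.
Proof.
elim=> {x y w} [x w _ w0|x y z w _ xz _ IH]; first by lra.
by have := g_adj xz; lra.
Qed.

Lemma cluster_reach x y : c x = c y -> reach G [pred z | c z == c x] x y r.
Proof.
move=> cxy; have h := c_reach x; have := reach_sym (c_reach y).
by rewrite -cxy => /(reach_trans h); rewrite -splitr.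
Qed.

Lemma route_ge s t x w : route s t x w -> g x <= w.
Proof.
elim=> {x w} [y i _|tN _|x z w _ xz _ IH].
- by rewrite lerDl mulr_ge0 // L_ge0.
- by have := g_le t tN; rewrite distxx // sub0r.
- by have := g_adj xz; lra.
Qed.

Lemma route_near s k t x w : valid s k -> route s t x w -> t \in N /\ d x t <= w + delta t.
Proof.
move=> gs; elim=> {x w} [y i sy|tN _|x z w _ xz _ [tN IH]].
- by split; [apply: valid_net gs _ _ _ sy|apply/(dist_le_reach connG)/(valid_reach gs sy)].
- by rewrite distxx // addNr.
- split=> //; have := dist_triangle connG z x t; have := dist_adj connG xz; lra.
Qed.

(** Follow a geodesic from [x] to a net point attaining [g x], up to the first assigned vertex. The
    potential there exceeds [g] by at most [k * L]. *)
Lemma route_exists s k x : valid s k -> exists t w, route s t x w /\ w <= g x + k%:R * L.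
Proof.
move=> gs; have [t tN gx] := g_attained x.
have [p [pp lp dx]] := dist_geodesic connG x t; rewrite dx in gx.
have : walk_weight G x p - delta t <= g x by rewrite gx.
elim: p x pp lp {gx dx} => [|z p IH] x /=; case sx: (s x) => [[t' i]|].
1,3: move=> _ _ _; exists t', (g x + i%:R * L); split; first exact: route_src.
1,2: by rewrite lerD2l ler_wpM2r ?L_ge0 // ler_nat (valid_round gs sx).
- move=> _ xt; move: sx; rewrite xt => sN; exists t, (- delta t); split; first exact: route_own.
  have := mulr_ge0 (ler0n R k) L_ge0; lra.
- move=> /andP[xz pz] lz gx; have [|t' [w [vz wz]]] := IH z pz lz.
    by have := g_adj xz; lra.
  exists t', (wt G x z + w); split; first exact: route_step.
  have : g z <= walk_weight G z p - delta t.
    by rewrite -lz; have := g_le z tN; have := dist_le_walk connG pz; rewrite lz; lra.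
  by have := g_adj xz; lra.
Qed.

Lemma reach_route s t (C : pred V) x y w w' :
  (forall z, C z -> s z = None) -> reach G C x y w -> route s t y w' ->
  exists2 w1, route s t x w1 & w1 <= w + w'.
Proof.
move=> CN; elim=> {x y w} [x w _ w0 v|x y z w Cx xz _ IH /IH [w1 v w1w]].
  by exists w' => //; lra.
by exists (wt G x z + w1); [apply: route_step => //; apply: CN|lra].
Qed.

Section Step.
Variables (s : state) (k : nat) (qf : V -> nat).
Hypothesis gs : valid s k.
Hypothesis qf_le : forall t, (qf t <= T)%N.

Lemma core_uniq t t' x x' : c x = c x' -> core s qf t x -> core s qf t' x' -> t = t'.
Proof.
move=> cx [sx [w v win]] [sx' [w' v' win']]; apply/eqP/negPn/negP => tt'.
have free z : [pred z | c z == c x] z -> s z = None.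
  by move=> /eqP /(valid_cluster gs) ->.
have free' z : [pred z | c z == c x'] z -> s z = None.
  by move=> /eqP /(valid_cluster gs) ->.
have [w1 v1 w1w] := reach_route free' (cluster_reach (esym cx)) v.
have [w2 v2 w2w] := reach_route free (cluster_reach cx) v'.
(* Each margin is [2 * r] and each transfer costs at most [r], so adding the two comparisons gives
   [4 * r <= 2 * r]. *)
have := win _ _ _ v2; rewrite eq_sym tt' => /(_ isT).
move=> h; have h' := win' _ _ tt' v1; suff: r <= 0 by rewrite leNgt r_gt0.
by move: h h'; lra.
Qed.

Lemma next_state_core t x x' : c x' = c x -> s x = None -> core s qf t x' ->
  next_state s qf k x = Some (t, k.+1).
Proof.
move=> cx sx ct; rewrite /next_state sx; case: pickP => [t' /asboolP[y cy ct']|].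
  by rewrite (core_uniq _ ct' ct) // cy.
by move=> /(_ t)/asboolP; case; exists x'.
Qed.

Lemma next_state_some x o : s x = Some o -> next_state s qf k x = Some o.
Proof. by move=> sx; rewrite /next_state sx. Qed.

Lemma owned_next_state t : subpred (owned s t) (owned (next_state s qf k) t).
Proof. by move=> z; rewrite /owned; case sz: (s z) => [a|] //; rewrite (next_state_some sz). Qed.

Lemma win_step t x z w : s x = None -> adj G x z ->
  wins s qf t x (wt G x z + w) -> wins s qf t z w.
Proof.
move=> sx xz win t' w' tt' v'.
by have := win _ _ tt' (route_step sx xz v'); lra.
Qed.

(** By [win_step] each vertex of the winning walk wins as well, so it joins [t] in this same round;
    from an earlier assigned source on, the invariant supplies the rest of the walk. *)
Lemma core_reach t x w : route s t x w -> wins s qf t x w ->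
  reach G (owned (next_state s qf k) t) x t (w + delta t).
Proof.
elim=> {x w} [y i sy _|tN sN win|x z w sx xz v IH win].
- exact: reach_subpred (@owned_next_state t) (valid_reach gs sy).
- rewrite addNr; apply: reach_refl => //.
  rewrite /owned (@next_state_core t t t) //; split => //; exists (- delta t) => //.
  exact: route_own.
- rewrite -addrA; apply: reach_step => //; last exact/IH/win_step/win.
  rewrite /owned (@next_state_core t x x) //; split => //; exists (wt G x z + w) => //.
  exact: route_step.
Qed.

(** Compare with the cheap route of [route_exists]. If it leads to another net point, the margin
    bounds [w]; if it leads to [t], the cheaper of the two routes is kept. *)
Lemma core_bound t x : core s qf t x -> exists w,
  [/\ route s t x w, wins s qf t x w & w <= g x + k%:R * L + 4 * r * T%:R].
Proof.
have rT (a : nat) : (a <= T)%N -> 4 * r * a%:R <= 4 * r * T%:R.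
  by move=> aT; rewrite ler_wpM2l ?ler_nat // mulr_ge0 // ltW.
have r0 (a : nat) : 0 <= 4 * r * a%:R by rewrite !mulr_ge0 // ltW.
move=> [sx [w v win]]; have [t0 [w0 [v0 w0g]]] := route_exists x gs.
have [tt0|tt0] := eqVneq t0 t; last first.
  exists w; split => //; have := win _ _ tt0 v0.
  by have := rT _ (qf_le t); have := r0 (qf t0); have := r_gt0; lra.
rewrite {}tt0 in v0; have := r0 T; have [ww0|w0w] := leP w w0.
  by exists w; split => //; lra.
exists w0; split => //; last by lra.
by move=> t' w' tt' v'; have := win _ _ tt' v'; lra.
Qed.

Lemma next_state_valid : valid (next_state s qf k) k.+1.
Proof.
split.
- by move=> x y cxy; rewrite /next_state (valid_cluster gs cxy) cxy.
- move=> y t i; rewrite /next_state; case sy: (s y) => [a|].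
    by case=> aE; rewrite {}aE in sy; apply: leqW; apply: valid_round gs _ _ _ sy.
  by case: pickP => // t' _ [_ <-].
- move=> y t i; rewrite /next_state; case sy: (s y) => [a|].
    by case=> aE; rewrite {}aE in sy; apply: valid_net gs _ _ _ sy.
  case: pickP => // t' /asboolP[x' _ [_ [w v _]]] [<- _].
  by have [] := route_near gs v.
- move=> y t i; case sy: (s y) => [a|].
    rewrite (next_state_some sy) => -[aE]; rewrite {}aE in sy.
    exact: reach_subpred (@owned_next_state t) (valid_reach gs sy).
  rewrite {1}/next_state sy; case: pickP => // t' /asboolP[x' cx' ct] [tt' <-].
  rewrite {t'}tt' in ct; have [w [v win wg]] := core_bound ct.
  have yx' : reach G (owned (next_state s qf k) t) y x' r.
    apply: reach_subpred (cluster_reach (esym cx')) => z /eqP cz.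
    by rewrite /owned (next_state_core _ _ ct) // ?cz // (valid_cluster gs cz).
  apply: reach_weaken (reach_trans yx' (core_reach v win)).
  have := g_reach (reach_sym yx'); rewrite -[k.+1%:R]natr1; lra.
Qed.

End Step.

(** * Locality of the rounds *)

Variable D : R.
Hypothesis delta_bnd : forall t, 0 <= delta t <= D.
Hypothesis g_bnd : forall x, - D <= g x <= D.
Hypothesis TL_le : T%:R * L <= D / 2.
Hypothesis T_gt0 : (0 < T)%N.

Lemma L_le : L <= D / 2.
Proof.
apply: le_trans TL_le; rewrite -[leLHS]mul1r ler_wpM2r ?L_ge0 //.
by rewrite ler1n.
Qed.

Lemma kL_le k : (k < T)%N -> k%:R * L + L <= D / 2.
Proof.
move=> kT; apply: le_trans TL_le; rewrite -[X in _ + X]mul1r -mulrDl natr1.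
by rewrite ler_wpM2r ?L_ge0 // ler_nat.
Qed.

Lemma r_le : 4 * r * T%:R + 2 * r = L.
Proof. by ring. Qed.

Lemma rT_ge0 (a : nat) : 0 <= 4 * r * a%:R.
Proof. by rewrite !mulr_ge0 // ltW. Qed.

Lemma rT_le (a : nat) : (a <= T)%N -> 4 * r * a%:R <= 4 * r * T%:R.
Proof. by move=> aT; rewrite ler_wpM2l ?ler_nat // mulr_ge0 // ltW. Qed.

Lemma D_ge0 : 0 <= D.
Proof. by have := L_ge0; have := L_le; lra. Qed.

(** Potentials of sources are at least [- D], so a route of weight [w] has length at most
    [w + D]. *)
Lemma route_local s s' t x w rho : route s t x w -> w + D <= rho ->
  (forall y, d x y <= rho -> s y = s' y) -> route s' t x w.
Proof.
move=> v; have := route_ge v; elim: v rho => {x w} [y i sy|tN sN|x z w sx xz v IH] rho gw wr ss.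
- apply: route_src; rewrite -ss // distxx //.
  by have /andP[] := g_bnd y; lra.
- apply: route_own; rewrite // -ss // distxx //.
  by have /andP[] := g_bnd t; lra.
- apply: route_step => //.
    by rewrite -ss // distxx //; have /andP[] := g_bnd x; lra.
  apply: (IH (rho - wt G x z)); [exact: route_ge v|lra|move=> y zy].
  by apply: ss; have := dist_triangle connG z x y; have := dist_adj connG xz; lra.
Qed.

(** A winning route may be taken of weight at most [2 * D]. A competing route above [2 * D] loses by
    the required margin whatever the bonuses are, so all relevant data lie within [3 * D]. *)
Lemma core_local s s' k (qf qf' : V -> nat) t x : valid s k -> (k < T)%N ->
  (forall t, qf t <= T)%N -> (forall t, qf' t <= T)%N ->
  (forall y, d x y <= 3 * D -> s y = s' y) ->
  (forall t, t \in N -> d x t <= 3 * D -> qf t = qf' t) ->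
  core s qf t x -> core s' qf' t x.
Proof.
move=> gs kT qT qT' ss qq ct; have sx : s x = None by case: ct.
have le3 (a : R) : a <= 2 * D -> a + D <= 3 * D by lra.
have [w [v win wg]] := core_bound gs qT ct; split.
  by rewrite -ss // distxx // mulr_ge0 // D_ge0.
have /andP[_ gD] := g_bnd x; have kL := kL_le kT; have Ld := L_le; have rL := r_le.
have w2 : w <= 2 * D by have := D_ge0; have := r_gt0; lra.
have [tN dt] := route_near gs v; have /andP[_ deltat] := delta_bnd t.
exists w; first by apply: route_local v _ ss; apply: le3.
have dt3 : d x t <= 3 * D by rewrite (le_trans dt) // (le_trans _ (le3 _ w2)) // lerD2l.
move=> t' w' tt' v'; rewrite -(qq t) //.
have [w'D|w'D] := leP w' (2 * D).
  have v'' : route s t' x w'.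
    apply: (route_local (rho := 3 * D) v'); last by move=> y /ss ->.
    exact: le3.
  have [t'N dt'] := route_near gs v''; have /andP[_ deltat'] := delta_bnd t'.
  have dt3' : d x t' <= 3 * D by rewrite (le_trans dt') // (le_trans _ (le3 _ w'D)) // lerD2l.
  by rewrite -(qq t') //; apply: win.
have := rT_ge0 (qf t); have := rT_le (qT' t'); have := r_gt0; lra.
Qed.

Local Notation X := (V * 'I_T.+1 * 'I_T.+1)%type.
Local Notation Omega := {ffun X -> bool}.
Implicit Types (f h : Omega).

Definition heads f (k : nat) t : nat := lead (fun i => f (t, inord k, inord i)) T.

Fixpoint run f (k : nat) : state :=
  if k is k'.+1 then next_state (run f k') (heads f k') k' else fun=> None.

Lemma heads_le f k t : (heads f k t <= T)%N. Proof. exact: lead_le. Qed.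

Lemma run_valid f k : valid (run f k) k.
Proof. by elim: k => [|k IH]; [split|apply: next_state_valid IH (heads_le f k)]. Qed.

Lemma run_local_core f h k t x : (k < T)%N ->
  (forall y, d x y <= 3 * D -> run f k y = run h k y) ->
  (forall t, t \in N -> d x t <= 3 * D -> heads f k t = heads h k t) ->
  core (run f k) (heads f k) t x -> core (run h k) (heads h k) t x.
Proof.
move=> kT; exact: core_local (run_valid f k) kT (heads_le f k) (heads_le h k).
Qed.

(** A round looks [3 * D] around each vertex of the cluster, whose diameter is at most [r <= D];
    hence [4 * D] per round. *)
Lemma run_local f h k x : (k <= T)%N ->
  (forall t j i, t \in N -> d x t <= k%:R * (4 * D) -> (j < k)%N ->
     f (t, inord j, i) = h (t, inord j, i)) ->
  run f k x = run h k x.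
Proof.
elim: k x => //= k IH x kT fh.
have r_le_D : r <= D by have := L_le; have := r_le; have := rT_ge0 T; have := D_ge0; lra.
have stE y : d x y <= 4 * D -> run f k y = run h k y.
  move=> xy; apply: IH; first exact: ltnW.
  move=> t j i tN dt jk; apply: fh => //; last exact: ltnW.
  by have := dist_triangle connG y x t; rewrite -natr1; lra.
have headsE t : t \in N -> d x t <= 4 * D -> heads f k t = heads h k t.
  move=> tN dt; apply: eq_lead => i _; apply: fh => //; apply: le_trans dt _.
  by rewrite ler_peMl ?mulr_ge0 ?D_ge0 // ler1n.
rewrite /next_state -stE ?distxx ?mulr_ge0 ?D_ge0 //; case: (run f k x) => //.
suff -> : [pick t | `[< exists2 x', c x' = c x & core (run f k) (heads f k) t x' >]] =
          [pick t | `[< exists2 x', c x' = c x & core (run h k) (heads h k) t x' >]] by [].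
apply: eq_pick => t.
have near x' y : c x' = c x -> d x' y <= 3 * D -> d x y <= 4 * D.
  move=> cx; have := dist_le_reach connG (cluster_reach (esym cx)).
  by have := dist_triangle connG x' x y; lra.
apply/asboolP/asboolP => -[x' cx ct]; exists x' => //; apply: run_local_core ct => //.
- by move=> y /(near _ _ cx) /stE.
- by move=> t' t'N /(near _ _ cx) /(headsE _ t'N).
- by move=> y /(near _ _ cx) /stE.
- by move=> t' t'N /(near _ _ cx) /(headsE _ t'N).
Qed.

Lemma run_causal f h k : (k <= T)%N ->
  (forall t j i, (j < k)%N -> f (t, inord j, i) = h (t, inord j, i)) -> run f k = run h k.
Proof. by move=> kT fh; apply/funext => x; apply: run_local => // t j i _ _; apply: fh. Qed.

(** * Leaders of a round *)

Section Survival.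
Variables (s : state) (k : nat) (x : V).
Hypothesis gs : valid s k.

Let costs t : set R := [set w | route s t x w]%classic.
Definition candidate t : Prop := exists w, route s t x w.
(** Without a route to [t] the infimum is a mere default value; therefore leaders are compared among
    candidates only. *)
Definition score qf t : R := 4 * r * (qf t)%:R - inf (costs t).
Definition leader qf t : Prop :=
  candidate t /\ forall t', candidate t' -> score qf t' <= score qf t.

Lemma inf_costs_le t w : route s t x w -> inf (costs t) <= w.
Proof. by move=> v; apply: ge_inf => //; exists (g x) => u /route_ge. Qed.

Lemma inf_costs_adherent t e : 0 < e -> candidate t ->
  exists2 w, route s t x w & w < inf (costs t) + e.
Proof.
move=> e0 [w v]; apply: inf_adherent => //; split; first by exists w.
by exists (g x) => u /route_ge.
Qed.

Lemma leader_exists qf : exists t, leader qf t.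
Proof.
have [t0 [w0 [v0 _]]] := route_exists x gs.
have c0 : `[< candidate t0 >] by apply/asboolP; exists w0.
have [t /asboolP ct tmax] := arg_maxP (P := fun t => `[< candidate t >]) (score qf) c0.
by exists t; split => // t' ct'; apply: tmax; apply/asboolP.
Qed.

(** Half of the lead pays for a route within [2 * r] of the infimum; the other half is the margin in
    [wins]. *)
Lemma gap_core qf t : s x = None -> candidate t ->
  (forall t', t' != t -> candidate t' -> score qf t' + 4 * r <= score qf t) ->
  core s qf t x.
Proof.
move=> sx ct gap; split => //.
have [|w v wi] := @inf_costs_adherent t (2 * r) _ ct; first by rewrite mulr_gt0.
exists w => // t' w' tt' v'; have ct' : candidate t' by exists w'.
by have := gap _ tt' ct'; have := inf_costs_le v'; rewrite /score; lra.
Qed.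

Lemma leader_near qf t : (k < T)%N -> (forall t, qf t <= T)%N -> leader qf t ->
  t \in N /\ d x t <= 4 * D.
Proof.
move=> kT qT [ct tmax].
have [t0 [w0 [v0 w0g]]] := route_exists x gs.
have := tmax t0 (ex_intro _ w0 v0); rewrite /score => h0.
have [|w v wi] := @inf_costs_adherent t (2 * r) _ ct; first by rewrite mulr_gt0.
have [tN dt] := route_near gs v; split => //.
have := inf_costs_le v0; have := rT_ge0 (qf t0); have := rT_le (qT t).
have /andP[_ deltat] := delta_bnd t; have /andP[_ gD] := g_bnd x.
by have := kL_le kT; have := r_le; have := r_gt0; have := D_ge0; lra.
Qed.

End Survival.

(** * Each round halves the probability of survival *)

Section Halving.
Variables (x : V) (k : nat).
Hypothesis kT : (k < T)%N.

(** Leaders lie within [4 * D], so with room the leader has a tail that can be flipped. Rows of [T]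
    heads are excluded later by bad events of their own. *)
Definition room f j := [forall t in N, (d x t <= 4 * D) ==> (heads f j t < T)%N].
Definition alive j : {set Omega} :=
  [set f | (run f j x == None) && [forall i : 'I_T.+1, (i < j)%N ==> room f i]].

Let tp f : V := odflt x [pick t | `[< leader (run f k) x (heads f k) t >]].
Let pos f : X := (tp f, inord k, inord (heads f k (tp f))).
(* Changing the first tail of the leader in round k into a head gives it a margin of
   4 * r, so x gets assigned. The change is injective on alive (k + 1) because the
   leader and the position of the coin can be recovered from the new scores. *)
Let flip f : Omega := [ffun p => if p == pos f then true else f p].

Let tpP f : leader (run f k) x (heads f k) (tp f).
Proof.
rewrite /tp; case: pickP => [t /asboolP//|h].
by have [t /asboolP] := leader_exists x (run_valid f k) (heads f k); rewrite h.
Qed.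

Let run_flip f : run (flip f) k = run f k.
Proof.
apply: run_causal => [|t j i jk]; first exact: ltnW.
rewrite ffunE /pos; case: eqP => // -[_ /(congr1 (@nat_of_ord _))].
by rewrite !inordK ?ltnS ?(ltnW kT) // ?(ltnW (ltn_trans jk kT)) // => jE; rewrite jE ltnn in jk.
Qed.

Let heads_flip f j t : (j <= T)%N -> (j, t) <> (k, tp f) ->
  heads (flip f) j t = heads f j t.
Proof.
move=> jT jt; apply: eq_lead => i _; rewrite ffunE; case: eqP => // -[tE /(congr1 (@nat_of_ord _))].
by rewrite !inordK ?ltnS ?(ltnW kT) // => jE; rewrite jE tE in jt.
Qed.

Let heads_flip_tp f : (heads f k (tp f) < T)%N ->
  (heads f k (tp f) < heads (flip f) k (tp f))%N.
Proof.
move=> hT; apply: lead_ge => // l; rewrite ltnS leq_eqVlt => lh; rewrite ffunE /pos.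
case: eqP => // ne; case/predU1P: lh => [lE|]; first by rewrite lE in ne.
exact: lead_head.
Qed.

Let aliveS f : f \in alive k.+1 ->
  [/\ f \in alive k, (forall t, ~ core (run f k) (heads f k) t x) &
      (heads f k (tp f) < T)%N].
Proof.
rewrite !inE => /andP[/= sx /forallP rm].
have [tN dt] := leader_near (run_valid f k) kT (heads_le f k) (tpP f).
have sx' : run f k x = None by move: sx; rewrite /next_state; case: (run f k x).
split.
- rewrite sx' eqxx; apply/forallP => i; apply/implyP => ik.
  by apply: (implyP (rm i)); apply: ltnW.
- by move=> t ct; rewrite (next_state_core (run_valid f k) _ sx' ct) in sx.
- have /implyP := rm (inord k); rewrite inordK ?ltnS ?(ltnW kT) // => /(_ (leqnn k)).
  by move=> /forall_inP /(_ _ tN) /implyP /(_ dt).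
Qed.

Let score_flip f t : t != tp f ->
  score (run f k) x (heads (flip f) k) t = score (run f k) x (heads f k) t.
Proof.
by move=> tt; rewrite /score heads_flip ?(ltnW kT) // => -[tE]; rewrite tE eqxx in tt.
Qed.

Let score_flip_tp f : f \in alive k.+1 ->
  score (run f k) x (heads f k) (tp f) + 4 * r <= score (run f k) x (heads (flip f) k) (tp f).
Proof.
move=> /aliveS[_ _ /heads_flip_tp]; rewrite -(ler_nat R) -natr1 => h.
have : 4 * r * ((heads f k (tp f))%:R + 1) <= 4 * r * (heads (flip f) k (tp f))%:R.
  by rewrite ler_wpM2l // mulr_ge0 // ltW.
by rewrite /score; lra.
Qed.

Let flip_gap f t : f \in alive k.+1 -> t != tp f -> candidate (run f k) x t ->
  score (run f k) x (heads (flip f) k) t + 4 * r <= score (run f k) x (heads (flip f) k) (tp f).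
Proof.
move=> fa tt ct; rewrite score_flip //; apply: le_trans (score_flip_tp fa).
by rewrite lerD2r; have [_] := tpP f; apply.
Qed.

Let flip_alive f : f \in alive k.+1 -> flip f \in alive k :\: alive k.+1.
Proof.
move=> fa; have [+ _ _] := aliveS fa; rewrite !inE run_flip => /andP[sx rm].
have ct : core (run f k) (heads (flip f) k) (tp f) x.
  apply: gap_core; [exact/eqP|by have [] := tpP f|].
  by move=> t; apply: flip_gap.
rewrite sx /= run_flip (next_state_core (run_valid f k) _ (eqP sx) ct) //=.
apply/forallP => i; apply/implyP => ik; apply/forall_inP => t tN; apply/implyP => dt.
rewrite heads_flip; [|by rewrite -ltnS|by case=> iE; rewrite iE ltnn in ik].
by move/forallP: rm => /(_ i)/implyP/(_ ik)/forall_inP/(_ t tN)/implyP/(_ dt).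
Qed.

Let flip_inj : {in alive k.+1 &, injective flip}.
Proof.
move=> f h fa ha fh.
have sE : run f k = run h k by rewrite -run_flip fh run_flip.
(* Two different leaders would each lead the other by [4 * r] in the same flipped scores. *)
have tE : tp f = tp h.
  apply/eqP/negPn/negP => tt.
  have ctf : candidate (run f k) x (tp h) by rewrite sE; have [] := tpP h.
  have cth : candidate (run h k) x (tp f) by rewrite -sE; have [] := tpP f.
  have tt' : tp h != tp f by rewrite eq_sym.
  have h1 := flip_gap fa tt' ctf; have := flip_gap ha tt cth; rewrite -fh -sE => h2.
  suff : r <= 0 by rewrite leNgt r_gt0.
  by move: h1 h2; lra.
(* The other net points score the same under [f1] and [f2]. If the common leader had more heads
   under [f2], it would already lead by [4 * r] there without the flip, and [x] would not
   survive. *)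
have lt_absurd f1 f2 : f1 \in alive k.+1 -> f2 \in alive k.+1 -> flip f1 = flip f2 ->
    run f1 k = run f2 k -> tp f1 = tp f2 ->
    ~ (heads f1 k (tp f1) < heads f2 k (tp f2))%N.
  move=> a1 a2 fE s12 t12 lt12; have [_ ncore _] := aliveS a2.
  apply: (ncore (tp f2)); apply: gap_core.
  - by move: a2 => /aliveS[]; rewrite inE => /andP[/eqP].
  - by have [] := tpP f2.
  move=> t tt ct.
  have e : score (run f1 k) x (heads f1 k) t = score (run f2 k) x (heads f2 k) t.
    by rewrite -(@score_flip f1) ?t12 // -(@score_flip f2) // fE s12.
  have [_ /(_ t)] := tpP f1; rewrite e s12 => /(_ ct) h1.
  move: lt12; rewrite -(ler_nat R) -natr1 => lt12.
  have : 4 * r * ((heads f1 k (tp f1))%:R + 1) <= 4 * r * (heads f2 k (tp f2))%:R.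
    by rewrite ler_wpM2l // mulr_ge0 // ltW.
  by move: h1; rewrite /score t12; lra.
have hE : heads f k (tp f) = heads h k (tp h).
  case: (ltngtP (heads f k (tp f)) (heads h k (tp h))) => // lt; first by case: (lt_absurd f h fa ha fh sE tE lt).
  by case: (lt_absurd h f ha fa (esym fh) (esym sE) (esym tE) lt).
have pE : pos f = pos h by rewrite /pos hE tE.
have tailf g' : g' \in alive k.+1 -> g' (pos g') = false.
  move=> /aliveS[_ _ hT]; exact: (lead_tail hT).
apply/ffunP => p; have /ffunP /(_ p) := fh; rewrite !ffunE -pE.
by case: eqP => // ->; rewrite tailf // pE tailf.
Qed.

(** [alive k.+1] and its injective image under [flip] are disjoint subsets of [alive k]. *)
Lemma alive_half : (2 * #|alive k.+1| <= #|alive k|)%N.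
Proof.
have sub : alive k.+1 \subset alive k by apply/subsetP => f /aliveS[].
have := subset_leq_card (_ : flip @: alive k.+1 \subset alive k :\: alive k.+1).
rewrite card_in_imset // => h.
have : (#|alive k.+1| <= #|alive k :\: alive k.+1|)%N.
  by apply: h; apply/subsetP => _ /imsetP[f fa ->]; apply: flip_alive.
by rewrite -(leq_add2l #|alive k.+1|) addnn -mul2n cardsD (setIidPr sub) subnKC ?subset_leq_card.
Qed.

End Halving.

Lemma alive_card x : (#|alive x T| * 2 ^ T <= #|[set: Omega]|)%N.
Proof.
suff h k : (k <= T)%N -> (#|alive x k| * 2 ^ k <= #|[set: Omega]|)%N by exact: h.
elim: k => [|k IH] kT; first by rewrite muln1 subset_leq_card // subsetT.
apply: leq_trans (IH (ltnW kT)).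
by rewrite expnS mulnCA mulnA leq_mul2r alive_half ?orbT.
Qed.

Lemma alive_depends x :
  depends_on [set p : X | (p.1.1 \in N) && (d x p.1.1 <= T%:R * (4 * D))] (alive x T).
Proof.
move=> f h fh; rewrite !inE; have D0 : 0 <= 4 * D by rewrite mulr_ge0 // D_ge0.
have -> : run f T x = run h T x.
  by apply: run_local => // t j i tN dt _; apply: fh; rewrite inE /= tN.
congr (_ && _); apply: eq_forallb => i; congr (_ ==> _).
apply: eq_forallb_in => t tN; case: (boolP (d x t <= 4 * D)) => //= dt.
congr (_ < _)%N; apply: eq_lead => l _; apply: fh; rewrite inE /= tN.
by apply: le_trans dt _; rewrite ler_peMl // ler1n.
Qed.

Section AllAssigned.
Variable B : nat.
Hypothesis B_gt0 : (0 < B)%N.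
Hypothesis B_le : (4 * B <= 2 ^ T)%N.
Hypothesis cardB : forall x,
  (#|[set v | c v == v] :&: gball G x (2 * T%:R * (4 * D))| +
   #|N :&: gball G x (2 * T%:R * (4 * D))| * T.+1 <= B)%N.

(** Bad events: a centre survives all rounds with room, or a net point shows [T] heads in one round.
    If none occurs, [room] always holds, so every centre is assigned, and its cluster with it.
    Events that share coins have centres within [2 * T * (4 * D)], which bounds the degree by
    [B]. *)
Lemma all_assigned : exists f, forall x, run f T x <> None.
Proof.
pose J := (V + V * 'I_T.+1)%type.
pose row (p : V * 'I_T.+1) : {set X} := [set a : X | (a.1 == p) && (a.2 < T)%N].
pose vb (i : J) : {set X} := match i with
  | inl x => if c x == x
             then [set p : X | (p.1.1 \in N) && (d x p.1.1 <= T%:R * (4 * D))] else set0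
  | inr p => if p.1 \in N then row p else set0 end.
pose E (i : J) : {set Omega} := match i with
  | inl x => if c x == x then alive x T else set0
  | inr p => if p.1 \in N then [set f : Omega | [forall a in row p, f a]] else set0 end.
have D0 : 0 <= 4 * D by rewrite mulr_ge0 // D_ge0.
have card_row p : #|row p| = T.
  have -> : row p = (fun i => (p, lift ord_max i)) @: [set: 'I_T].
    apply/setP => -[p' i]; rewrite !inE /=.
    apply/andP/imsetP => [[/eqP -> iT]|[j _ [-> ->]]]; last by rewrite eqxx lift_max ltn_ord.
    by exists (Ordinal iT); rewrite ?inE //; congr pair; apply: val_inj; rewrite [RHS]lift_max.
  by rewrite card_imset ?cardsT ?card_ord // => i j [e]; apply: (@lift_inj _ ord_max); apply: val_inj.
have [||||f fE] := @lovasz_local_lemma X J E vb B.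
- case=> [x|p] f h /=; first by case: ifP => _ fh; [apply: alive_depends|rewrite !inE].
  case: ifP => _ fh; rewrite !inE //; apply: eq_forallb_in => a ap; exact: fh.
- exact: B_gt0.
- move=> i; pose ctr : V := match i with inl x => x | inr p => p.1 end.
  have near a : a \in vb i -> a.1.1 \in N /\ d ctr a.1.1 <= T%:R * (4 * D).
    rewrite /vb /ctr; case: i {ctr} => [x|p].
      by case: ifP => _; rewrite !inE // => /andP[].
    case: ifP => pN; rewrite !inE // => /andP[/eqP -> _]; split => //.
    by rewrite distxx // mulr_ge0.
  have TD0 : 0 <= T%:R * (4 * D) by rewrite mulr_ge0.
  pose A1 : {set J} := inl @: ([set v | c v == v] :&: gball G ctr (2 * T%:R * (4 * D))).
  pose A2 : {set J} := inr @: setX (N :&: gball G ctr (2 * T%:R * (4 * D))) [set: 'I_T.+1].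
  apply: leq_trans (cardB ctr); apply: leq_trans (_ : #|A1 :|: A2| <= _)%N.
    apply/subset_leq_card/subsetP => j; rewrite inE -setI_eq0 => /set0Pn[a].
    rewrite in_setI => /andP[/near[aN da]]; rewrite in_setU /vb; case: j => [x|[t j]].
      case: ifP => cx; last by rewrite inE.
      rewrite in_set => /andP[_ dx]; apply/orP; left; apply: imset_f.
      rewrite in_setI inE cx gballE // distC //.
      by have := dist_triangle connG a.1.1 ctr x; rewrite (distC connG a.1.1 x); lra.
    case: ifP => pN; last by rewrite inE.
    rewrite in_set => /andP[/eqP ap _]; apply/orP; right; apply: imset_f.
    rewrite in_setX in_setT andbT in_setI pN gballE // distC //.
    by move: da; rewrite ap /=; lra.
  apply: leq_trans (leq_card_setU _ _) _.
  rewrite card_imset; last by move=> ? ? [].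
  rewrite card_imset; last by move=> ? ? [].
  by rewrite leq_add2l cardsX cardsT card_ord.
- move=> i; apply: (@leq_trans (#|E i| * 2 ^ T)).
    by rewrite mulnC leq_mul2l B_le orbT.
  rewrite /E; case: i => [x|p]; case: ifP => _; rewrite ?cards0 //; first exact: alive_card.
  by have := card_all_heads (row p); rewrite card_row.
exists f => x sx; have := fE (inl (c x)); rewrite /E c_idem eqxx inE.
rewrite (valid_cluster (run_valid f T) (c_idem x)) sx eqxx /= => /negP; apply.
apply/forallP => i; apply/implyP => iT; apply/forall_inP => t tN; apply/implyP => _.
rewrite ltn_neqAle heads_le andbT; apply/negP => /eqP hT.
have := fE (inr (t, i)); rewrite /E /= tN inE => /negP; apply.
apply/forall_inP => -[p l]; rewrite inE /= => /andP[/eqP -> lT].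
have := @lead_head (fun l => f (t, inord i, inord l)) T l; rewrite -/(heads f i t) hT.
by rewrite !inord_val; apply.
Qed.

End AllAssigned.
End Rounds.

(** * The hierarchy *)

Section Levels.
Local Open Scope ring_scope.
Variables (R : realType) (V : finType) (G : wgraph R V).
Hypothesis connG : wconnected G.
Local Notation d := (dist G).

(* c maps every vertex to a centre of its cluster: the clusters are the fibres of c,
   and centres are fixed points. *)
Record level (alpha : R) (tau : nat) (r : R) (c : V -> V) : Prop := Level {
  level_idem : forall x, c (c x) = c x;
  level_reach : forall x, reach G [pred z | c z == c x] x (c x) (r / 2);
  level_sparse : forall v, (#|c @: gball G v (r / alpha)| <= tau)%N }.

(** * One coarsening step *)

Section Coarsening.
Variables (lam ell k kA kB Q T : nat).
Hypothesis QE : Q = (3 * ell).+1.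
Hypothesis dblG : has_doubling_constant G lam.
Hypothesis lam_le : (lam <= 2 ^ ell)%N.
Hypothesis kA_ge : (256 * Q <= 2 ^ kA)%N.
Hypothesis k_ge : (4 * (2 ^ (ell * kA) * (4 * Q + 5)) <= 2 ^ k)%N.
Hypothesis T_gt0 : (0 < T)%N.
Hypothesis kB_ge : (192 * Q * T ^ 3 * (16 * (4 * Q + 1)) <= 2 ^ kB)%N.
Hypothesis T_ge : (4 * (2 ^ (ell * kB) * (2 * k + T.+1)) <= 2 ^ T)%N.

(** With [M = 24 * T ^ 2 * r] these give [gamma * r = (4 * Q + 1) * M] and
    [gamma * r / alpha = M / 16]. *)
Local Notation alpha := (16 * (4 * Q + 1))%:R.
Local Notation gamma := (24 * T ^ 2 * (4 * Q + 1))%:R.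

Lemma coarser_level (r : R) (c : V -> V) : 0 < r -> level alpha (2 * k) r c ->
  exists c', level alpha (2 * k) (gamma * r) c' /\ forall x, c' (c x) = c' x.
Proof.
move=> r0 [c_idem c_reach c_sparse].
have T1 : 1 <= T%:R :> R by rewrite ler1n.
have Q1 : 1 <= Q%:R :> R by rewrite ler1n QE.
(* The factor 24 makes the total excess [T * L = (4 * T ^ 2 + 2 * T) * r] at most [M / 4]. *)
pose M := 24 * T%:R ^+ 2 * r; have Tr0 : 0 < T%:R :> R by rewrite ltr0n.
have M0 : 0 < M by rewrite /M !mulr_gt0 // exprn_gt0.
pose D := Q%:R * M; have D0 : 0 < D by rewrite mulr_gt0 // (lt_le_trans _ Q1).
have MD : M <= D by rewrite ler_peMl // ltW.
have [N [covN sepN]] := net_exists connG D0.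
have M16 : 0 < M / 16 by rewrite divr_gt0.
have [N' [covN' sepN']] := net_exists connG M16.
have [q [q_le q_sparse]] := sparse_shifts connG QE dblG lam_le kA_ge k_ge M0 covN sepN covN' sepN'.
pose delta t := M * (q t)%:R.
have delta_bnd t : 0 <= delta t <= D.
  by rewrite /delta mulr_ge0 ?(ltW M0) //= /D mulrC ler_wpM2r ?ler_nat ?q_le ?(ltW M0).
have gex x : exists y : R,
    (forall t, t \in N -> y <= d x t - delta t) /\ exists2 t, t \in N & y = d x t - delta t.
  have [t0 t0N _] := covN x.
  have [t tN tmin] := arg_minP (P := mem N) (fun t => d x t - delta t) t0N.
  by exists (d x t - delta t); split; [exact: tmin|exists t].
have [g gP] := choice gex.
have g_le x t : t \in N -> g x <= d x t - delta t by case: (gP x) => + _; apply.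
have g_att x : exists2 t, t \in N & g x = d x t - delta t by case: (gP x).
have g_bnd x : - D <= g x <= D.
  have [t tN xt] := covN x; have [t' t'N gx] := g_att x.
  have := g_le x t tN; have := dist_ge0 connG x t'.
  have /andP[] := delta_bnd t; have /andP[] := delta_bnd t'.
  by move=> *; apply/andP; split; move: xt; rewrite -/D gx; lra.
pose L := (4 * T%:R + 2) * r; have L0 : 0 <= L by rewrite mulr_ge0 ?ltW // addr_gt0 // mulr_gt0 // ltr0n.
have TL : T%:R * L <= M / 4.
  have : 0 <= (T%:R * r) * (T%:R - 1) by rewrite !mulr_ge0 ?subr_ge0 // ltW.
  by rewrite /M /L; lra.
have TL_le : T%:R * L <= D / 2 by lra.
have D2 : 2 * T%:R * (4 * D) <= 2 ^+ kB * (D / 2).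
  have : (16 * T)%:R <= (2 ^ kB)%:R :> R.
    rewrite ler_nat (leq_trans _ kB_ge) //.
    have -> : (192 * Q * T ^ 3 * (16 * (4 * Q + 1)) =
               16 * T * (192 * Q * T ^ 2 * (4 * Q + 1)))%N by ring.
    by rewrite leq_pmulr // !muln_gt0 ?expn_gt0 T_gt0 QE addn_gt0 orbT.
  rewrite natrX natrM => /(ler_wpM2r (ltW D0)); move: (2 ^+ kB) => P.
  by lra.
(* The quotient of the two radii is the left side of [kB_ge]: [kB] doublings lead from the sparsity
   radius of the old clusters to the dependency radius. *)
have Da : 2 * T%:R * (4 * D) <= 2 ^+ kB * (r / alpha).
  rewrite [leRHS]mulrA ler_pdivlMr ?ltr0n ?muln_gt0 ?addn_gt0 ?orbT //.
  have : (192 * Q * T ^ 3 * (16 * (4 * Q + 1)))%:R <= (2 ^ kB)%:R :> R by rewrite ler_nat.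
  rewrite natrX => /(ler_wpM2r (ltW r0)); apply: le_trans; rewrite le_eqVlt; apply/orP; left; apply/eqP.
  by rewrite /D /M !natrM; ring.
have cardB x :
    (#|[set v | c v == v] :&: gball G x (2 * T%:R * (4 * D))| +
     #|N :&: gball G x (2 * T%:R * (4 * D))| * T.+1 <= 2 ^ (ell * kB) * (2 * k + T.+1))%N.
  have lamB : (lam ^ kB <= 2 ^ (ell * kB))%N by rewrite expnM leq_expl.
  rewrite mulnDr; apply: leq_add.
    have ra : 0 < r / alpha by rewrite divr_gt0 // ltr0n muln_gt0 addn_gt0 orbT.
    apply: (@leq_trans (2 * k * lam ^ kB)); last by rewrite mulnC leq_mul2r lamB orbT.
    have sp y : (#|c @: (setT :&: gball G y (r / alpha))| <= 2 * k)%N.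
      by rewrite setTI; apply: c_sparse.
    apply: leq_trans (card_imset_ball connG dblG x ra sp Da).
    apply/subset_leq_card/subsetP => y; rewrite in_setI inE => /andP[/eqP cy yx].
    by apply/imsetP; exists y; rewrite ?setTI.
  rewrite leq_mul2r; apply/orP; right; apply: leq_trans _ lamB.
  by have := card_separated_ball connG dblG x D0 sepN D2.
have B0 : (0 < 2 ^ (ell * kB) * (2 * k + T.+1))%N by rewrite muln_gt0 expn_gt0 addnS.
have [f fP] := all_assigned connG r0 c_idem c_reach g_le g_att delta_bnd g_bnd TL_le T_gt0 B0 T_ge cardB.
pose s := run G c r N delta g f T.
have gs : valid G c r N delta g T s T by exact: run_valid.
pose c' x := if s x is Some (t, _) then t else x.
have sP x : exists i, s x = Some (c' x, i).
  have := fP x; rewrite -/s /c'; case: (s x) => [[t i]|] // _; by exists i.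
have s_reach x : [/\ c' x \in N, reach G (owned s (c' x)) x (c' x) (g x + T%:R * L + delta (c' x))
                   & owned s (c' x) (c' x)].
  have [i si] := sP x; have rx := valid_reach gs si; split; first exact: valid_net gs _ _ _ si.
    apply: reach_weaken rx; rewrite lerD2r lerD2l ler_wpM2r // ler_nat.
    exact: valid_round gs _ _ _ si.
  exact: reach_end rx.
have ownedE t z : owned s t z -> c' z = t by rewrite /owned /c'; case: (s z) => // -[t' _] /eqP.
exists c'; split; last first.
  by move=> x; have [i si] := sP x; rewrite {1}/c' (valid_cluster gs (c_idem x)) si.
have a0 : 0 < (4 * Q + 1)%:R :> R by rewrite ltr0n addn_gt0 orbT.
have gammaE : gamma * r = (4 * Q + 1)%:R * M by rewrite /M !natrM; ring.
split.
(* The walk of [valid_reach] ends at the net point, which therefore belongs to its own part. *)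
- by move=> x; have [_ _ /ownedE] := s_reach x.
- move=> x; have [_ rx _] := s_reach x.
  (* The radius is at most [2 * D + M / 4], below half of [gamma * r = (4 * Q + 1) * M]. *)
  apply: reach_weaken (reach_subpred _ rx); last by move=> z /ownedE /= ->.
  rewrite gammaE natrD natrM; have /andP[_ gD] := g_bnd x.
  by have /andP[_ deltaD] := delta_bnd (c' x); rewrite /D in gD deltaD; lra.
- move=> v; apply: leq_trans (q_sparse v); apply/subset_leq_card/subsetP => _ /imsetP[u + ->].
  have -> : gamma * r / alpha = M / 16.
    by rewrite gammaE natrM; field; rewrite gt_eqF.
  rewrite gballE // inE => uv; have [cN ru _] := s_reach u; rewrite cN /=.
  (* The loss is [M / 4] from the rounds plus [M / 16] twice for moving between [u] and [v]: this is
     the slack [3 / 8 * M] of [sparse_shifts]. *)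
  apply/forall_inP => t tN; have := dist_le_reach connG ru; have := g_le u t tN.
  have := dist_triangle connG v u t; have := dist_triangle connG u v (c' u).
  by rewrite (distC connG v u) /delta; lra.
Qed.

End Coarsening.
End Levels.

(** * From coarsening steps to a hierarchy *)

Section Hierarchy.
Local Open Scope ring_scope.
Variables (R : realType) (V : finType) (G : wgraph R V).
Hypothesis connG : wconnected G.
Hypothesis minG : min_dist_one G.
Local Notation d := (dist G).

Lemma level_partition alpha tau r c : level G alpha tau r c ->
  strong_sparse_partition G r alpha tau (preim_partition c setT).
Proof.
move=> [c_idem c_reach c_sparse].
have blockP C : C \in preim_partition c setT -> exists x, C = [set y in setT | c x == c y].
  by case/imsetP => x _ ->; exists x.
split; first exact: preim_partitionP.
- move=> _ /blockP[a ->]; apply: gdiam_induced_le => x y.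
  rewrite !inE => /eqP ax /eqP ay; rewrite (splitr r).
  have sub z : c z = c a -> subpred [pred u | c u == c z] (mem [set u in setT | c a == c u]).
    by move=> cz u /= /eqP cu; rewrite !inE cu cz eqxx.
  apply: (@reach_trans _ _ _ _ (c x)); first exact/(reach_subpred _ (c_reach x))/sub.
  have -> : c x = c y by rewrite -ax.
  by apply: reach_sym; apply/(reach_subpred _ (c_reach y))/sub.
- move=> v; apply: leq_trans (c_sparse v).
  apply: leq_trans (leq_imset_card (fun b => [set y in setT | b == c y]) _).
  apply/subset_leq_card/subsetP => C; rewrite inE => /andP[/blockP[x ->]].
  rewrite -setI_eq0 => /set0Pn[u]; rewrite in_setI => /andP[+ uv].
  by rewrite !inE => /eqP ->; apply: imset_f; apply: imset_f.
Qed.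

(** Balls of radius [1 / alpha] are singletons, since the minimum distance is 1. *)
Lemma level_id alpha tau : 1 < alpha -> (0 < tau)%N -> level G alpha tau 1 id.
Proof.
move=> a1 t0; split => // [x|v].
  by apply: reach_refl; rewrite /= ?eqxx // divr_ge0.
rewrite imset_id; apply: leq_trans t0; rewrite -(cards1 v); apply/subset_leq_card/subsetP => u.
rewrite gballE // inE => uv; apply/negPn/negP => /(dist_ge1 connG minG).
have : 1 / alpha < 1 by rewrite ltr_pdivrMr ?mul1r // (lt_trans _ a1).
by lra.
Qed.

Lemma total_partition r alpha tau : (0 < #|V|)%N -> (0 < tau)%N -> (forall x y, d x y <= r) ->
  strong_sparse_partition G r alpha tau [set setT].
Proof.
move=> V0 t0 dr; split.
- rewrite /partition /cover big_set1 eqxx /=; apply/andP; split.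
    by apply/trivIsetP => A B; rewrite !inE => /eqP -> /eqP ->; rewrite eqxx.
  by rewrite inE eq_sym -card_gt0 cardsT.
- move=> C; rewrite inE => /eqP ->; apply: gdiam_induced_le => x y _ _.
  apply: reach_weaken (dr x y) _; have [p [pp lp ->]] := dist_geodesic connG x y.
  elim: p x pp lp => [|z p IH] x /=; first by move=> _ ->; apply: reach_refl; rewrite //= inE.
  by move=> /andP[xz pz] lz; apply: reach_step; rewrite /= ?inE //; apply: IH.
- move=> v; apply: leq_trans t0; rewrite -(cards1 [set: V]); apply/subset_leq_card/subsetP.
  by move=> C; rewrite inE => /andP[].
Qed.

(** The ball of radius 1 around an endpoint of a pair at distance 1 contains both points, while
    balls of radius [1 / 2] are singletons. Hence the doubling dimension is at least 1. *)
Lemma doubling_constant_ge2 l : has_doubling_constant G l -> (2 <= l)%N.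
Proof.
move=> h; have [x [y [xy dxy]]] := dist_eq1 connG minG.
have [|S [cS sS]] := h x (1 / 2); first by rewrite divr_gt0.
have inb z : d z x <= 1 -> exists2 s, s \in S & d z s <= 1 / 2.
  move=> zx; have /(subsetP sS)/bigcupP[s sS' zs] : z \in gball G x (2 * (1 / 2)).
    by rewrite gballE //; lra.
  by exists s; rewrite // -gballE.
have inS z : d z x <= 1 -> z \in S.
  move=> /inb[s sS' zs]; suff -> : z = s by [].
  by apply/eqP/negPn/negP => /(dist_ge1 connG minG); lra.
have xS : x \in S by apply: inS; rewrite distxx.
have yS : y \in S by apply: inS; rewrite distC // dxy.
apply: leq_trans cS; rewrite (cardsD1 x) xS (cardsD1 y) !inE eq_sym xy yS.
by rewrite addnA leq_addr.
Qed.

Lemma hierarchy_exists alpha gamma tau : 1 < alpha -> 1 < gamma -> (0 < tau)%N ->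
  (2 <= #|V|)%N ->
  (forall r c, 0 < r -> level G alpha tau r c ->
     exists c', level G alpha tau (gamma * r) c' /\ forall x, c' (c x) = c' x) ->
  exists (k : nat) (C : nat -> {set {set V}}), strong_sparse_hierarchy G gamma alpha tau k C.
Proof.
move=> a1 g1 t0 V2 step.
have g0 : 0 < gamma by lra.
have [nxt nxtP] : exists nxt : R * (V -> V) -> V -> V, forall p,
    0 < p.1 -> level G alpha tau p.1 p.2 ->
    level G alpha tau (gamma * p.1) (nxt p) /\ forall x, nxt p (p.2 x) = nxt p x.
  (* The hypotheses sit under the existential, with [id] as junk value, so that [choice] applies to
     all pairs. *)
  have tot (p : R * (V -> V)) : exists c', 0 < p.1 -> level G alpha tau p.1 p.2 ->
      level G alpha tau (gamma * p.1) c' /\ forall x, c' (p.2 x) = c' x.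
    have [[r0 lp]|nlp] := pselect (0 < p.1 /\ level G alpha tau p.1 p.2).
      by have [c' hc'] := step _ _ r0 lp; exists c'.
    by exists id => r0 lp; case: nlp.
  by have [nxt h] := choice tot; exists nxt.
pose cs := fix cs i := if i is j.+1 then nxt (gamma ^+ j, cs j) else id : V -> V.
have csP i : level G alpha tau (gamma ^+ i) (cs i).
  elim: i => [|i IH]; first by rewrite expr0; apply: level_id.
  by rewrite exprS; case: (nxtP (gamma ^+ i, cs i)) => //; rewrite /= exprn_gt0.
have csS i x : cs i.+1 (cs i x) = cs i.+1 x.
  by case: (nxtP (gamma ^+ i, cs i)) => //; rewrite /= ?exprn_gt0.
pose diam := \sum_(p : V * V) d p.1 p.2.
have diamP x y : d x y <= diam.
  rewrite /diam (bigD1 (x, y)) //= lerDl; apply: sumr_ge0 => p _; exact: dist_ge0.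
(* Bernoulli's inequality makes the powers of [gamma] exceed the sum of all distances, a crude bound
   on the diameter. *)
have [n nP] : exists n, diam <= gamma ^+ n.+1.
  have h m : 1 + (gamma - 1) * m%:R <= gamma ^+ m.
    elim: m => [|m IH]; first by rewrite mulr0 addr0.
    rewrite exprS; apply: le_trans (_ : gamma * (1 + (gamma - 1) * m%:R) <= _).
      have : 0 <= (gamma - 1) ^+ 2 * m%:R by rewrite mulr_ge0 // sqr_ge0.
      by rewrite -natr1; lra.
    by rewrite ler_pM2l.
  exists (Num.truncn (diam / (gamma - 1))); apply: le_trans (h _).
  have : diam / (gamma - 1) < (Num.truncn (diam / (gamma - 1))).+1%:R.
    exact: truncnS_gt.
  rewrite ltr_pdivrMr ?subr_gt0 //; lra.
(* The last level is replaced by the one-block partition, which coarsens every partition. *)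
exists n.+1, (fun i => if (i <= n)%N then preim_partition (cs i) setT else [set setT]).
split => /=.
- apply/setP => A; apply/imsetP/imsetP => -[x _ ->]; exists x => //; apply/setP => y;
    by rewrite !inE eq_sym.
- by rewrite ltnn.
- move=> i iN; case: leqP => // [_|ni]; first exact: level_partition.
  have -> : i = n.+1 by apply/eqP; rewrite eqn_leq iN.
  apply: total_partition => //; first exact: ltnW.
  by move=> x y; apply: le_trans (diamP x y) nP.
- move=> i; rewrite ltnS => iN; rewrite iN; case: leqP => _.
    by move=> U _; exists setT; [rewrite inE|exact: subsetT].
  move=> U /imsetP[x _ ->]; exists [set y in setT | cs i.+1 x == cs i.+1 y].
    by apply/imsetP; exists x.
  apply/subsetP => y; rewrite !inE => /eqP xy.
  by apply/eqP; rewrite -[LHS](csS i x) -[RHS](csS i y) xy.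
Qed.

End Hierarchy.

(** * Numerical parameters *)

Section Constants.
Variable ell : nat.
Hypothesis ell_gt0 : 0 < ell.
Let s := up_log 2 ell.+1.
Let Q := (3 * ell).+1.

Let s_gt0 : 0 < s. Proof. by rewrite up_log_gt0. Qed.
Let ell_lt : ell < 2 ^ s. Proof. exact: up_logP. Qed.
Let s_lt : s < 2 ^ s. Proof. exact: ltn_expl. Qed.
Let Q_le : Q <= 2 ^ (s + 2). Proof. by rewrite expnD /Q; lia. Qed.
Let Q4_le : 4 * Q + 5 <= 2 ^ (s + 4). Proof. by rewrite expnD /Q; lia. Qed.

Lemma param_kA : 256 * Q <= 2 ^ (s + 10).
Proof. by rewrite (expnD 2 s 10); have := ell_lt; rewrite /Q; lia. Qed.

Lemma param_k : 4 * (2 ^ (ell * (s + 10)) * (4 * Q + 5)) <= 2 ^ (18 * ell * s).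
Proof.
apply: (@leq_trans (2 ^ 2 * (2 ^ (ell * (s + 10)) * 2 ^ (s + 4)))).
  by rewrite leq_mul2l leq_mul2l Q4_le !orbT.
rewrite -!expnD leq_exp2l //; nia.
Qed.

Let T_le : 64 * ell * s <= 2 ^ (2 * s + 6).
Proof.
rewrite expnD mul2n -addnn expnD.
have : ell * s <= 2 ^ s * 2 ^ s by apply: leq_mul; apply: ltnW.
lia.
Qed.

(** The exponents add up to [8 * s + 36], and [s] is positive. *)
Lemma param_kB : 192 * Q * (64 * ell * s) ^ 3 * (16 * (4 * Q + 1)) <= 2 ^ (44 * s).
Proof.
apply: (@leq_trans (2 ^ 8 * 2 ^ (s + 2) * (2 ^ (2 * s + 6)) ^ 3 * (2 ^ 4 * 2 ^ (s + 4)))).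
  apply: leq_mul; last by rewrite leq_mul2l; apply/orP; right; apply: leq_trans Q4_le; lia.
  by apply: leq_mul; [apply: leq_mul|apply: leq_expl].
by rewrite -expnM -!expnD leq_exp2l //; lia.
Qed.

(** [T = 64 * ell * s] occurs on both sides, but on the left only as a factor: the left exponent is
    at most [44 * ell * s + 2 * s + 9]. *)
Lemma param_T : 4 * (2 ^ (ell * (44 * s)) * (2 * (18 * ell * s) + (64 * ell * s).+1)) <=
  2 ^ (64 * ell * s).
Proof.
have es : 0 < ell * s by rewrite muln_gt0 ell_gt0.
apply: (@leq_trans (2 ^ 2 * (2 ^ (ell * (44 * s)) * 2 ^ (2 * s + 7)))).
  rewrite leq_mul2l leq_mul2l; apply/orP; right; apply/orP; right.
  have : ell * s <= 2 ^ s * 2 ^ s by apply: leq_mul; apply: ltnW.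
  by rewrite (_ : 2 * s + 7 = s + s + 7) ?expnD; lia.
have : s <= ell * s by rewrite leq_pmull.
rewrite -!expnD leq_exp2l //; lia.
Qed.

End Constants.

(** * Logarithms and soft-O bounds *)

Section Asymptotics.
Local Open Scope ring_scope.
Variable R : realType.
Implicit Types (C e x : R) (k j m : nat).

(** Since [1 + ln e >= 1], one [K] can dominate both the constant factor and the logarithmic
    exponent. *)
Lemma softO_intro C k j : exists K : nat, forall e x, 1 <= e ->
  x <= C * e ^+ k * (1 + ln e) ^+ j -> x <= softO_bound K k e.
Proof.
exists ((Num.truncn C).+1 + j)%N => e x e1 /le_trans; apply; rewrite /softO_bound.
have ln1 : 1 <= 1 + ln e by rewrite lerDl ln_ge0.
have e0 : 0 <= e ^+ k by rewrite exprn_ge0 // (le_trans _ e1).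
set K := (_ + j)%N.
have CK : C <= K%:R.
  by rewrite (le_trans (ltW (truncnS_gt C))) // ler_nat leq_addr.
apply: le_trans (_ : K%:R * e ^+ k * (1 + ln e) ^+ j <= _).
  by rewrite -!mulrA ler_wpM2r // mulr_ge0 // exprn_ge0 // (le_trans _ ln1).
by rewrite ler_wpM2l ?mulr_ge0 // ler_weXn2l // leq_addl.
Qed.

Lemma ln2_ge : 1 / 2 <= ln 2 :> R.
Proof.
have h : ln (1 + - (1 / 2)) <= - (1 / 2) :> R by apply: le_ln1Dx; lra.
have e : 1 + - (1 / 2) = 2^-1 :> R by field.
by move: h; rewrite e lnV ?lerN2 // posrE.
Qed.

Lemma exp_le_ln j e : (2 ^ j)%:R <= e -> j%:R * ln 2 <= ln e.
Proof.
rewrite natrX => je; have j0 : 0 < 2 ^+ j :> R by rewrite exprn_gt0.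
by rewrite mulr_natl -lnXn // ler_ln // posrE // (lt_le_trans j0).
Qed.

(** Rounding the logarithm up adds at most 1, which [1 <= e] absorbs into the factor 2. *)
Lemma up_log_le m e : (1 < m)%N -> e = ln m%:R / ln 2 ->
  1 <= e /\ (up_log 2 m)%:R <= 2 * e.
Proof.
move=> m1 eE; have ln20 : 0 < ln 2 :> R by rewrite ln_gt0 // ltr1n.
have h j : (2 ^ j <= m)%N -> j%:R <= e.
  by rewrite -(ler_nat R) => /exp_le_ln; rewrite eE ler_pdivlMr.
have e1 : 1 <= e by apply: (h 1%N).
have u0 : (0 < up_log 2 m)%N by rewrite up_log_gt0.
have := h (up_log 2 m).-1; rewrite ltnW ?up_log_gtn // => /(_ isT).
by split => //; rewrite -(prednK u0) -natr1; lra.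
Qed.

Lemma up_log_succ_le m e : (0 < m)%N -> 1 <= e -> m%:R <= 2 * e ->
  (up_log 2 m.+1)%:R <= 2 * (1 + ln e).
Proof.
move=> m0 e1 me; have u0 : (0 < up_log 2 m.+1)%N by rewrite up_log_gt0.
have e0 : 0 < e by rewrite (lt_le_trans _ e1).
have : (2 ^ (up_log 2 m.+1).-1)%:R <= 2 * e.
  by apply: le_trans me; rewrite ler_nat -ltnS up_log_gtn.
move/exp_le_ln; rewrite lnM ?posrE // -{2}(prednK u0) -natr1 => h.
have := ln2_ge; have := ln_ge0 e1; nra.
Qed.

End Asymptotics.

Local Open Scope ring_scope.

Theorem theorem6p5 (R : realType) :
  exists Ka Kt Kg : nat,
  forall (V : finType) (G : wgraph R V),
    (2 <= #|V|)%N -> wconnected G -> min_dist_one G ->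
  exists (alpha gamma : R) (tau : nat),
    [/\ 0 < alpha,
        alpha <= Ka%:R * doubling_dim G,
        tau%:R <= softO_bound Kt 1 (doubling_dim G),
        gamma <= softO_bound Kg 3 (doubling_dim G)
      & exists (k : nat) (C : nat -> {set {set V}}),
          strong_sparse_hierarchy G gamma alpha tau k C].
Proof.
(* With [ell <= 2 * e] and [s <= 2 * (1 + ln e)]: [tau = 36 * ell * s] gives 144, [gamma <= 24 * (64
   * ell * s) ^ 2 * 17 * ell] gives the factor 32, and [alpha <= 272 * ell] gives 544. *)
have [Kt KtP] := softO_intro (144 : R) 1 1.
have [Kg KgP] := softO_intro (24 * 64 ^+ 2 * 17 * 32 : R) 3 2.
exists 544, Kt, Kg => V G V2 connG minG.
set e := doubling_dim G.
have dblG : has_doubling_constant G (doubling_constant G).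
  by rewrite /doubling_constant; case: ex_minnP => l /asboolP.
have lam2 := doubling_constant_ge2 connG minG dblG.
have [e1 elle] := up_log_le lam2 (erefl e).
set ell := up_log 2 (doubling_constant G) in elle.
have ell0 : (0 < ell)%N by rewrite up_log_gt0.
have := up_log_succ_le ell0 e1 elle; set s := up_log 2 ell.+1 => se.
have lam_le : (doubling_constant G <= 2 ^ ell)%N by exact: up_logP.
have s0 : (0 < s)%N by rewrite up_log_gt0.
pose Q := (3 * ell).+1; pose T := (64 * ell * s)%N.
have T0 : (0 < T)%N by rewrite !muln_gt0 ell0.
have ell1 : 1 <= ell%:R :> R by rewrite ler1n.
have l1 : 1 <= 1 + ln e by rewrite lerDl ln_ge0.
exists (16 * (4 * Q + 1))%:R, (24 * T ^ 2 * (4 * Q + 1))%:R, (2 * (18 * ell * s))%N.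
have Q4 : (4 * Q + 1)%:R <= 17 * ell%:R :> R.
  have : Q%:R = 3 * ell%:R + 1 :> R by rewrite /Q -addn1 natrD natrM.
  by rewrite natrD natrM; lra.
split.
- by rewrite ltr0n muln_gt0 addn_gt0 orbT.
- by rewrite natrM; move: Q4; lra.
- apply: KtP => //; rewrite !natrM expr1.
  have : ell%:R * s%:R <= (2 * e) * (2 * (1 + ln e)) by apply: ler_pM.
  by rewrite expr1; lra.
- apply: KgP => //; rewrite natrM natrM natrX /T !natrM.
  have se2 : s%:R ^+ 2 <= (2 * (1 + ln e)) ^+ 2 by rewrite ler_sqr ?nnegrE //; lra.
  have el3 : ell%:R ^+ 3 <= (2 * e) ^+ 3 by rewrite lerXn2r ?nnegrE //; lra.
  apply: (@le_trans _ _ (24 * 64 ^+ 2 * 17 * (ell%:R ^+ 3 * s%:R ^+ 2))).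
    have c0 : 0 <= 24 * (64 * ell%:R * s%:R) ^+ 2 :> R by rewrite mulr_ge0 // sqr_ge0.
    apply: le_trans (ler_wpM2l c0 Q4) _; rewrite le_eqVlt; apply/orP; left; apply/eqP; ring.
  have := ler_pM (exprn_ge0 3 (ler0n R ell)) (exprn_ge0 2 (ler0n R s)) el3 se2.
  have c0 : 0 <= 24 * 64 ^+ 2 * 17 :> R by rewrite !mulr_ge0.
  move=> /(ler_wpM2l c0) /le_trans; apply; rewrite le_eqVlt; apply/orP; left; apply/eqP; ring.
apply: hierarchy_exists => //.
- by rewrite ltr1n; lia.
- by rewrite ltr1n /Q; nia.
- by rewrite !muln_gt0 ell0.
exact: (coarser_level connG (erefl Q) dblG lam_le (param_kA ell0) (param_k ell0) T0
  (param_kB ell0) (param_T ell0)).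
Qed.
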